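(* For every $\alpha\ge1$, the semi-circle law $$\mu_1:=\frac{1}{\pi}\,\delta_0\otimes\sqrt{2-x_2^2}\;\mathcal{H}^1\llcorner(-\sqrt2,\sqrt2),$$ that is, the product of the Dirac mass at $x_1=0$ and the measure on the $x_2$-axis with density $\frac1\pi\sqrt{2-x_2^2}$ on $(-\sqrt2,\sqrt2)$, is the unique minimiser of $I_\alpha$ among probability measures in $\mathcal{P}(\mathbb{R}^2)$.
   Context: $\mathcal{P}(\mathbb{R}^2)$ is the set of Borel probability measures on $\mathbb{R}^2$. For $\alpha\in\mathbb{R}$ the interaction kernel is $$W_\alpha(x_1,x_2)=-\frac12\log(x_1^2+x_2^2)+\alpha\frac{x_1^2}{x_1^2+x_2^2},\qquad x=(x_1,x_2)\in\mathbb{R}^2\setminus\{0\},\qquad W_\alpha(0):=+\infty.$$ The energy of $\mu\in\mathcal{P}(\mathbb{R}^2)$ is $$I_\alpha(\mu)=\frac12\iint_{\mathbb{R}^2\times\mathbb{R}^2}W_\alpha(x-y)\,d\mu(x)\,d\mu(y)+\frac12\int_{\mathbb{R}^2}|x|^2\,d\mu(x),$$ understood as the single integral $\frac12\iint\big[W_\alpha(x-y)+\frac12(|x|^2+|y|^2)\big]\,d\mu(x)\,d\mu(y)\in(-\infty,+\infty]$. $\mathcal{H}^1\llcorner A$ is the one-dimensional Hausdorff (Lebesgue) measure restricted to $A$. *)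

(* Defs.v *)
From HB Require Import structures.
From mathcomp Require Import all_boot all_order all_algebra.
From mathcomp Require Import all_classical all_reals all_analysis.
From mathcomp Require Import measurable_realfun ring lra.

Set Implicit Arguments.
Unset Strict Implicit.
Unset Printing Implicit Defensive.

Import Order.TTheory GRing.Theory Num.Theory.
Import numFieldNormedType.Exports.

Local Open Scope classical_set_scope.
Local Open Scope ring_scope.

(* The product sigma-algebra on this type is the Borel sigma-algebra of R^2. *)
Notation plane R := (measurableTypeR R * measurableTypeR R)%type.

(* Squared Euclidean norm; the library norm on pairs is the max norm. *)
Definition sqnorm (R : realType) (x : plane R) : R := x.1 ^+ 2 + x.2 ^+ 2.

Definition W (R : realType) (alpha : R) (x : plane R) : \bar R :=
  if x == 0 then +oo%E
  else (- (2^-1 * ln (sqnorm x)) + alpha * (x.1 ^+ 2 / sqnorm x))%:E.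

(* The integrand is bounded below, so the integral (positive part minus
   negative part) is meaningful and lies in (-oo, +oo]. Splitting it into an
   interaction and a confinement term could produce oo - oo. *)
Definition energy (R : realType) (alpha : R) (mu : probability (plane R) R) :
    \bar R :=
  ((2^-1)%R%:E * \int[(mu \x mu)%E]_p
     (W alpha (p.1 - p.2)%R + (2^-1 * (sqnorm p.1 + sqnorm p.2))%R%:E))%E.

Definition is_minimiser (R : realType) (alpha : R)
    (mu : probability (plane R) R) : Prop :=
  forall nu : probability (plane R) R, (energy alpha mu <= energy alpha nu)%E.

Definition semicircle_pdf (R : realType) (t : R) : R :=
  pi^-1 * Num.sqrt (2 - t ^+ 2).

Definition semicircle (R : realType) (A : set (measurableTypeR R)) : \bar R :=
  (\int[lebesgue_measure]_(t in A `&` `](- Num.sqrt 2)%R, (Num.sqrt 2)%R[)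
     (semicircle_pdf t)%:E)%E.

Section semicircle_probability.
Variable R : realType.
Local Notation mu := (@lebesgue_measure R).
Local Notation semicircle := (@semicircle R).

Let pdf_ge0 (t : R) : 0 <= semicircle_pdf t.
Proof. by rewrite /semicircle_pdf mulr_ge0// ?invr_ge0 ?pi_ge0. Qed.

Let continuous_pdf : continuous (@semicircle_pdf R).
Proof.
move=> t; apply: cvgM; first exact: cvg_cst.
apply: (continuous_comp (f := fun t : R => 2 - t ^+ 2)).
  by apply: cvgB; [exact: cvg_cst | exact: exprn_continuous].
exact: sqrt_continuous.
Qed.

Let measurable_pdf : measurable_fun setT (@semicircle_pdf R).
Proof. exact: continuous_measurable_fun. Qed.

Let semicircle0 : semicircle set0 = 0%E.
Proof. by rewrite /semicircle set0I integral_set0. Qed.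

Let semicircle_ge0 A : (0 <= semicircle A)%E.
Proof. by apply: integral_ge0 => t _; rewrite lee_fin. Qed.

Let semicircle_sigma_additive : semi_sigma_additive semicircle.
Proof.
move=> /= F mF tF mUF; rewrite /semicircle; apply: cvg_toP.
  apply: ereal_nondecreasing_is_cvgn => m n mn.
  apply: lee_sum_nneg_natr => // k _ _.
  by apply: integral_ge0 => /= x Fkx; rewrite lee_fin.
rewrite setI_bigcupl ge0_integral_bigcup//=.
- by move=> k; exact: measurableI.
- apply: measurable_funTS; apply: measurableT_comp => //.
- by move=> x _; rewrite lee_fin.
- exact: trivIset_setIr.
Qed.

HB.instance Definition _ := isMeasure.Build _ _ _ semicircle
  semicircle0 semicircle_ge0 semicircle_sigma_additive.

(* Substitute t = sqrt 2 * sin u. *)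
Let semicircle_setT : semicircle setT = 1%E.
Proof.
rewrite /semicircle setTI -(@integral_itv_bndoo R _ _ _ true false); last first.
  by apply: measurable_funTS; apply: measurableT_comp.
have s2 : 0 < Num.sqrt 2 :> R by rewrite sqrtr_gt0.
have pi0 : 0 < pi :> R by exact: pi_gt0.
have ab : - (pi / 2) < pi / 2 :> R by lra.
pose F (u : R) : R := Num.sqrt 2 * sin u.
have dF (u : R) : is_derive u 1 F (Num.sqrt 2 * cos u).
  by rewrite /F; apply: is_derive_eq.
have F'E : F^`()%classic = (fun u => Num.sqrt 2 * cos u).
  by apply/funext => u; rewrite derive1E derive_val.
have cF' : continuous (F^`()%classic).
  by rewrite F'E => u; apply: cvgM; [exact: cvg_cst | exact: continuous_cos].
have cF : continuous F.
  by move=> u; apply: cvgM; [exact: cvg_cst | exact: continuous_sin].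
have Fb : F (pi / 2) = Num.sqrt 2 by rewrite /F sin_pihalf mulr1.
have Fa : F (- (pi / 2)) = - Num.sqrt 2.
  by rewrite /F sinN sin_pihalf mulrN1.
rewrite -Fa -Fb integration_by_substitution_increasing; last 7 first.
- exact: ltW.
- by move=> x y xI yI xy; rewrite /F ltr_pM2l// ltr_sin.
- by move=> x _; exact: cF'.
- by apply/cvg_ex; exists (F^`()%classic (- (pi / 2))); exact/cvg_at_right_filter/cF'.
- by apply/cvg_ex; exists (F^`()%classic (pi / 2)); exact/cvg_at_left_filter/cF'.
- split => [x _||].
  + exact: ex_derive.
  + exact/cvg_at_right_filter/cF.
  + exact/cvg_at_left_filter/cF.
- exact/continuous_subspaceT/continuous_pdf.
pose g (u : R) : R := pi^-1 * (2 * cos u ^+ 2).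
pose G (u : R) : R := pi^-1 * (u + sin u * cos u).
transitivity (\int[mu]_(u in `[(- (pi / 2))%R, (pi / 2)%R]) (g u)%:E)%E.
  apply: eq_integral.
  move=> u; rewrite inE/= in_itv/= => uI; congr EFin.
  rewrite F'E !fctE/= /semicircle_pdf /g /F exprMn sqr_sqrtr//.
  rewrite -{1}(mulr1 2) -mulrBr -cos2sin2 sqrtrM// sqrtr_sqr.
  rewrite ger0_norm ?cos_ge0_pihalf// -[in RHS](sqr_sqrtr (ler0n R 2)).
  ring.
have cG : continuous G.
  move=> u; apply: cvgM; first exact: cvg_cst.
  apply: cvgD; first exact: cvg_id.
  by apply: cvgM; [exact: continuous_sin | exact: continuous_cos].
have dG (u : R) : is_derive u 1 G (g u).
  rewrite /G; apply: is_derive_eq.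
  by rewrite /g /GRing.scale/=; congr (_ * _); have := cos2Dsin2 u; nra.
rewrite (@continuous_FTC2 _ _ G)//.
- rewrite -EFinB /G sinN cosN cos_pihalf !mulr0 !addr0 -mulrBr opprK -splitr.
  by rewrite mulVf// gt_eqF.
- apply: continuous_subspaceT => u; apply: cvgM; first exact: cvg_cst.
  apply: cvgM; first exact: cvg_cst.
  by rewrite expr2; apply: cvgM; exact: continuous_cos.
- split => [x _||].
  + exact: ex_derive.
  + exact/cvg_at_right_filter/cG.
  + exact/cvg_at_left_filter/cG.
- by move=> u _; rewrite derive1E derive_val.
Qed.

HB.instance Definition _ :=
  @Measure_isProbability.Build _ _ R semicircle semicircle_setT.

End semicircle_probability.

Definition mu1 (R : realType) : probability (plane R) R :=
  (\d_(0%R : measurableTypeR R) \x @semicircle R)%E.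

(* Main.v *)
(* The kernel [W 1 (x - y)] together with its share of the confinement is the
   average, against the density [2 / pi * sin t ^+ 2] on [(0, pi)], of the
   one-dimensional kernel [- ln |u - v| + (u^2 + v^2) / 2] evaluated at the shear
   coordinates [u = x.2 + x.1 * cot t], [v = y.2 + y.1 * cot t]. Hence the energy
   for [alpha = 1] is an average of logarithmic energies of images of the measure
   on the line. Each of these is minimised only by the semicircle law, and the
   image of [mu1] under every shear coordinate is the semicircle law. For
   [alpha >= 1], [W alpha >= W 1], with equality along the second axis, so [mu1]
   is a minimiser. If [nu] is one, almost all of its images are semicircular, in
   particular supported in a fixed interval; as [t] tends to 0 this forces
   [x.1 = 0] almost surely.

   On the line, transport the semicircle law to [rho] by a nondecreasing [g] and
   use [- ln r >= 1 - r] with [r = (g s - g t) / (s - t)]. What is left is the bound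
   of the double integral of [r] by twice the integral of [t * g t], which
   expresses that the Hilbert transform of the semicircle law is the identity on
   its support. It is obtained from the Chebyshev expansion of the Cauchy kernel
   by Abel summation, which avoids principal values. *)

From HB Require Import structures.
Require Import Defs.
From mathcomp Require Import all_boot all_order all_algebra.
From mathcomp Require Import all_classical all_reals all_analysis.
From mathcomp Require Import measurable_realfun ring lra.

Set Implicit Arguments.
Unset Strict Implicit.
Unset Printing Implicit Defensive.

Import Order.TTheory GRing.Theory Num.Theory.
Import numFieldNormedType.Exports.

Local Open Scope classical_set_scope.
Local Open Scope ring_scope.

(** * Integration against the semicircle law *)

(** Dividing the projection by [sin t] lets a single line problem serve all directions: on the
    second axis the shear coordinate is [x.2] for every [t]. The weight [sin t ^+ 2] compensates. It
    clears the denominators of the confinement, whose average becomes [sqnorm]. As a function of [t]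
    it has only the frequencies 0 and 2, so averaging [- ln |cos (t - b)|] against it, with [b] the
    polar angle of [x - y], leaves a constant plus a multiple of [cos b ^+ 2]. The normalisation
    [2 / pi] makes that multiple 1, and the division by [sin t] contributes the opposite constant;
    hence exactly [W 1].

    The recurring obstacle is the subtraction of infinities: the kernels are [+oo] on the diagonal
    and the energy of a competitor may be infinite. Identities are therefore arranged between sums
    of nonnegative functions. The logarithmic kernel together with its confinement is nonnegative,
    so Tonelli applies to every measure, and only quantities shown to be finite are cancelled: the
    energy of the semicircle law, second moments, and one reference integral. *)

Section density.
Local Open Scope ereal_scope.
Context d (T : measurableType d) (R : realType).
Variables (mu nu : {measure set T -> \bar R}) (D : set T) (p : T -> R).
Hypothesis mD : measurable D.
Hypothesis mp : measurable_fun setT p.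
Hypothesis p_ge0 : forall x, (0 <= p x)%R.
Hypothesis nuE : forall A, measurable A -> nu A = \int[mu]_(x in A `&` D) (p x)%:E.

Import HBNNSimple.

(** [nu] is known only through its values on sets, so the formula is checked on the simple
    approximations of [f] and passes to the limit by monotone convergence on both sides. *)
Lemma ge0_integral_density (f : T -> \bar R) :
  measurable_fun setT f -> (forall x, 0 <= f x) ->
  \int[nu]_x f x = \int[mu]_(x in D) (f x * (p x)%:E).
Proof.
move=> mf f0; pose f_ := nnsfun_approx measurableT mf.
have mpD : measurable_fun D (EFin \o p) by exact/measurable_EFinP/measurable_funTS.
transitivity (limn (fun n => \int[nu]_x (f_ n x)%:E)).
  rewrite -monotone_convergence//.
  - apply: eq_integral => y _; apply/esym/cvg_lim => //.
    exact: cvg_nnsfun_approx.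
  - by move=> n; exact/measurable_EFinP/measurable_funP.
  - by move=> n y _; rewrite lee_fin.
  - by move=> y _ m n mn; rewrite lee_fin; exact/lefP/nd_nnsfun_approx.
rewrite [X in limn X](_ : _ =
    (fun n => \int[mu]_(x in D) ((f_ n x)%:E * (p x)%:E))).
  rewrite -monotone_convergence//; last 3 first.
    - move=> n /=; apply: emeasurable_funM => //.
      exact/measurable_EFinP/measurable_funTS.
    - by move=> n x _ /=; rewrite mule_ge0// lee_fin.
    - move=> x _ m n mn; rewrite lee_wpmul2r ?lee_fin//.
      exact/lefP/nd_nnsfun_approx.
  apply: eq_integral => x _; apply/cvg_lim => //.
  rewrite muleC; under eq_fun do rewrite muleC.
  by apply: cvgeZl => //; exact: cvg_nnsfun_approx.
apply/funext => n.
transitivity (\sum_(k \in range (f_ n))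
    \int[nu]_x (k * \1_(f_ n @^-1` [set k]) x)%:E).
  under eq_integral do rewrite fimfunE -fsumEFin//.
  rewrite ge0_integral_fsum//.
  - by move=> y; exact/measurable_EFinP/measurable_funM.
  - by move=> y x _; rewrite nnfun_muleindic_ge0.
transitivity (\sum_(k \in range (f_ n))
    \int[mu]_(x in D) ((k * \1_(f_ n @^-1` [set k]) x)%:E * (p x)%:E)); last first.
  rewrite -ge0_integral_fsum//; last 2 first.
  - by move=> y; apply: emeasurable_funM => //;
      exact/measurable_funTS/measurable_EFinP/measurable_funM.
  - by move=> y x _; rewrite mule_ge0 ?lee_fin// -lee_fin nnfun_muleindic_ge0.
  apply: eq_integral => x _; rewrite [in RHS]fimfunE -fsumEFin//.
  rewrite ge0_mule_fsuml//.
  by move=> y; rewrite nnfun_muleindic_ge0.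
apply: eq_fsbigr => r /[!inE] -[t _ <-].
rewrite integralZl_indic_nnsfun// integral_indic//= setIT nuE//.
under [RHS]eq_integral do rewrite EFinM -muleA.
rewrite ge0_integralZl//; last 3 first.
  - apply: emeasurable_funM => //.
    exact/measurable_EFinP/measurable_funTS/measurable_indic.
  - by move=> x _; rewrite mule_ge0 ?lee_fin.
  - by rewrite lee_fin.
congr (_ * _); rewrite setIC integral_mkcondr; apply: eq_integral => x _.
rewrite patchE indicE.
by case: ifPn => _; rewrite ?mul1e ?mul0e.
Qed.

End density.

Section semicircle.
Variable R : realType.
Local Notation leb := (@lebesgue_measure R).
Local Notation sc := (@semicircle R).

Lemma semicircle_pdf_ge0 (t : R) : 0 <= semicircle_pdf t.
Proof. by rewrite /semicircle_pdf mulr_ge0// ?invr_ge0 ?pi_ge0. Qed.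

Lemma continuous_semicircle_pdf : continuous (@semicircle_pdf R).
Proof.
move=> t; apply: cvgM; first exact: cvg_cst.
apply: (continuous_comp (f := fun t : R => 2 - t ^+ 2)).
  by apply: cvgB; [exact: cvg_cst | exact: exprn_continuous].
exact: sqrt_continuous.
Qed.

Lemma measurable_semicircle_pdf : measurable_fun setT (@semicircle_pdf R).
Proof. by apply: continuous_measurable_fun; exact: continuous_semicircle_pdf. Qed.

Lemma ge0_integral_semicircle (f : R -> \bar R) :
  measurable_fun setT f -> (forall x, (0 <= f x)%E) ->
  (\int[sc]_x f x = \int[leb]_(x in `](- Num.sqrt 2)%R, (Num.sqrt 2)%R[)
    (f x * (semicircle_pdf x)%:E))%E.
Proof.
move=> mf f0; apply: (ge0_integral_density (mu := leb) (nu := sc)) => //.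
- exact: measurable_semicircle_pdf.
- exact: semicircle_pdf_ge0.
Qed.

(* The substitution [t = sqrt 2 * sin u]. *)
Lemma ge0_integral_semicircle_sin (f : R -> R) :
  continuous f -> (forall x, 0 <= f x) ->
  (\int[sc]_x (f x)%:E = \int[leb]_(u in `[(- (pi / 2))%R, (pi / 2)%R])
    (f (Num.sqrt 2 * sin u) * (pi^-1 * (2 * cos u ^+ 2)))%:E)%E.
Proof.
move=> cf f0; rewrite ge0_integral_semicircle; last 2 first.
- by apply/measurable_EFinP; exact: continuous_measurable_fun.
- by move=> x; rewrite lee_fin.
have cfp : continuous (fun x : R => f x * semicircle_pdf x).
  by move=> x; apply: cvgM; [exact: cf|exact: continuous_semicircle_pdf].
under eq_integral do rewrite -EFinM.
rewrite -(@integral_itv_bndoo R _ _ _ true false); last first.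
  apply/measurable_EFinP/measurable_funTS.
  exact: (continuous_measurable_fun cfp).
have s2 : 0 < Num.sqrt 2 :> R by rewrite sqrtr_gt0.
have pi0 : 0 < pi :> R by exact: pi_gt0.
have ab : - (pi / 2) < pi / 2 :> R by lra.
pose F (u : R) : R := Num.sqrt 2 * sin u.
have dF (u : R) : is_derive u 1 F (Num.sqrt 2 * cos u).
  by rewrite /F; apply: is_derive_eq.
have F'E : F^`()%classic = (fun u => Num.sqrt 2 * cos u).
  by apply/funext => u; rewrite derive1E derive_val.
have cF' : continuous (F^`()%classic).
  by rewrite F'E => u; apply: cvgM; [exact: cvg_cst | exact: continuous_cos].
have cF : continuous F.
  by move=> u; apply: cvgM; [exact: cvg_cst | exact: continuous_sin].
have Fb : F (pi / 2) = Num.sqrt 2 by rewrite /F sin_pihalf mulr1.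
have Fa : F (- (pi / 2)) = - Num.sqrt 2.
  by rewrite /F sinN sin_pihalf mulrN1.
rewrite -Fa -Fb integration_by_substitution_increasing; last 7 first.
- exact: ltW.
- by move=> x y xI yI xy; rewrite /F ltr_pM2l// ltr_sin.
- by move=> x _; exact: cF'.
- by apply/cvg_ex; exists (F^`()%classic (- (pi / 2))); exact/cvg_at_right_filter/cF'.
- by apply/cvg_ex; exists (F^`()%classic (pi / 2)); exact/cvg_at_left_filter/cF'.
- split => [x _||].
  + exact: ex_derive.
  + exact/cvg_at_right_filter/cF.
  + exact/cvg_at_left_filter/cF.
- exact/continuous_subspaceT.
apply: eq_integral => u; rewrite inE/= in_itv/= => uI; congr EFin.
rewrite F'E !fctE/= -mulrA; congr (_ * _); first by rewrite Fb.
rewrite /semicircle_pdf /F exprMn sqr_sqrtr//.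
rewrite -{1}(mulr1 2) -mulrBr -cos2sin2 sqrtrM// sqrtr_sqr.
rewrite ger0_norm ?cos_ge0_pihalf// -[in RHS](sqr_sqrtr (ler0n R 2)).
ring.
Qed.

End semicircle.

(** * Continuity and measurability of real functions *)

Section continuous_real_functions.
Variable R : realType.
Implicit Types f g : R -> R.

Lemma continuous_cstr (c : R) : continuous (fun _ : R => c).
Proof. by move=> x; exact: cvg_cst. Qed.

Lemma continuous_idr : continuous (fun x : R => x).
Proof. by move=> x; exact: cvg_id. Qed.

Lemma continuous_addr f g : continuous f -> continuous g ->
  continuous (fun x => f x + g x).
Proof. by move=> cf cg x; apply: cvgD; [exact: cf|exact: cg]. Qed.

Lemma continuous_oppr f : continuous f -> continuous (fun x => - f x).
Proof. by move=> cf x; apply: cvgN; exact: cf. Qed.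

Lemma continuous_mulr f g : continuous f -> continuous g ->
  continuous (fun x => f x * g x).
Proof. by move=> cf cg x; apply: cvgM; [exact: cf|exact: cg]. Qed.

Lemma continuous_exprr f n : continuous f -> continuous (fun x => f x ^+ n).
Proof.
move=> cf; elim: n => [|n ih]; first exact: continuous_cstr.
have -> : (fun x => f x ^+ n.+1) = (fun x => f x * f x ^+ n).
  by apply/funext => x; rewrite exprS.
exact: continuous_mulr.
Qed.

Lemma continuous_sinr f : continuous f -> continuous (fun x => sin (f x)).
Proof. by move=> cf x; apply: continuous_comp; [exact: cf|exact: continuous_sin]. Qed.

Lemma continuous_cosr f : continuous f -> continuous (fun x => cos (f x)).
Proof. by move=> cf x; apply: continuous_comp; [exact: cf|exact: continuous_cos]. Qed.

Lemma continuous_divr f g : continuous f -> continuous g ->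
  (forall x, g x != 0) -> continuous (fun x => f x / g x).
Proof.
move=> cf cg g0 x; apply: cvgM; first exact: cf.
by apply: cvgV; [exact: g0|exact: cg].
Qed.

Lemma continuous_lnr f : continuous f -> (forall x, 0 < f x) ->
  continuous (fun x => ln (f x)).
Proof.
move=> cf f0 x; apply: continuous_comp; first exact: cf.
exact: continuous_ln.
Qed.

End continuous_real_functions.

Ltac continuity := lazymatch goal with
  | |- continuous (fun x => GRing.add (@?f x) (@?g x)) =>
      apply: (@continuous_addr _ f g); continuity
  | |- continuous (fun x => GRing.opp (@?f x)) =>
      apply: (@continuous_oppr _ f); continuity
  | |- continuous (fun x => GRing.mul (@?f x) (@?g x)) =>
      apply: (@continuous_mulr _ f g); continuity
  | |- continuous (fun x => GRing.exp (@?f x) ?n) =>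
      apply: (@continuous_exprr _ f n); continuity
  | |- continuous (fun x => sin (@?f x)) =>
      apply: (@continuous_sinr _ f); continuity
  | |- continuous (fun x => cos (@?f x)) =>
      apply: (@continuous_cosr _ f); continuity
  | |- continuous (fun x => x) => exact: continuous_idr
  | |- continuous (fun _ => _) => first [exact: continuous_cstr | assumption | idtac]
  | |- _ => try assumption
  end.

Section measurable_inverse.
Context d (T : measurableType d) (R : realType).

Lemma measurable_inv : measurable_fun [set: R] (@GRing.inv R).
Proof.
(* On a nonnegative base [powR _ (-1)] is the inverse; squaring first covers negative [x]. At 0 both
   sides are 0, since the inverse of 0 is 0. *)
rewrite [X in measurable_fun _ X](_ : _ = fun x => x * powR (x ^+ 2) (-1)).
  apply: measurable_funM => //.
  apply: (measurableT_comp (measurable_powR (-1))).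
  exact: exprn_measurable.
apply/funext => x; rewrite powR_inv1 ?sqr_ge0// expr2 invfM.
have [->|x0] := eqVneq x 0; first by rewrite invr0 mul0r.
by rewrite mulrA mulfV// mul1r.
Qed.

Lemma measurable_funV (f : T -> R) :
  measurable_fun setT f -> measurable_fun setT (fun x => (f x)^-1).
Proof. by move=> mf; exact: (measurableT_comp measurable_inv). Qed.

End measurable_inverse.

(** * Moments of the semicircle law and Chebyshev polynomials *)

Section semicircle_moments.
Variable R : realType.
Local Notation leb := (@lebesgue_measure R).
Local Notation sc := (@semicircle R).

(** The nonnegative weight commutes with taking positive and negative parts, so each part is
    transformed on its own and the difference makes sense for every continuous [f]. *)
Lemma integral_semicircle_sin (f : R -> R) : continuous f ->
  (\int[sc]_x (f x)%:E = \int[leb]_(u in `[(- (pi / 2))%R, (pi / 2)%R])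
    (f (Num.sqrt 2 * sin u) * (pi^-1 * (2 * cos u ^+ 2)))%:E)%E.
Proof.
move=> cf; rewrite integralE [RHS]integralE.
have w0 u : 0 <= (pi : R)^-1 * (2 * cos u ^+ 2).
  by rewrite mulr_ge0 ?invr_ge0 ?pi_ge0// mulr_ge0// sqr_ge0.
have cpos (h : R -> R) : continuous h -> continuous (fun x => Num.max (h x) 0).
  by move=> ch x; apply: continuous_max; [exact: ch|exact: cvg_cst].
have max_ge0 (h : R -> R) x : 0 <= Num.max (h x) 0.
  by rewrite le_max lexx orbT.
congr (_ - _)%E.
- transitivity (\int[sc]_x (Num.max (f x) 0)%:E)%E.
    by apply: eq_integral => x _; rewrite funeposE EFin_max.
  rewrite (ge0_integral_semicircle_sin (cpos _ cf))//.
  apply: eq_integral => u _.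
  by rewrite funeposE -EFin_max maxr_pMl// mul0r.
- have cNf : continuous (fun x => - f x) by move=> x; apply: cvgN; exact: cf.
  transitivity (\int[sc]_x (Num.max (- f x) 0)%:E)%E.
    by apply: eq_integral => x _; rewrite funenegE EFin_max EFinN.
  rewrite (ge0_integral_semicircle_sin (cpos _ cNf)); last exact: (max_ge0 (- f)).
  apply: eq_integral => u _.
  by rewrite funenegE -EFinN -EFin_max maxr_pMl// mul0r mulNr.
Qed.

Lemma FTC2_continuous (f F : R -> R) (a b : R) : a < b ->
  continuous f -> (forall u : R, is_derive u 1 F (f u)) ->
  (\int[leb]_(u in `[a, b]) (f u)%:E = (F b - F a)%:E)%E.
Proof.
move=> ab cf dF.
have cF : continuous F.
  move=> u; have dFu : derivable F u 1 by have := dF u; move=> ?; exact: ex_derive.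
  exact/differentiable_continuous/derivable1_diffP.
rewrite (@continuous_FTC2 _ _ F)// ?EFinB//.
- exact: continuous_subspaceT.
- split => [x _||].
  + exact: ex_derive.
  + exact/cvg_at_right_filter/cF.
  + exact/cvg_at_left_filter/cF.
- by move=> u _; rewrite derive1E derive_val.
Qed.

Lemma semicircle_second_moment : (\int[sc]_x (x ^+ 2)%:E = (2^-1)%:E)%E.
Proof.
rewrite integral_semicircle_sin; last exact: exprn_continuous.
(* The integrand is [sin (2 * u) ^+ 2 / pi], with primitive [(u / 2 - sin (4 * u) / 8) / pi]; [F] is
   this primitive with [sin (4 * u)] expanded in [sin u] and [cos u]. *)
pose F (u : R) : R :=
  pi^-1 * (u / 2 - sin u * cos u * (1 - 2 * sin u ^+ 2) / 2).
have pi0 : 0 < pi :> R by exact: pi_gt0.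
have pin0 : pi != 0 :> R by rewrite gt_eqF.
pose f (u : R) : R := (Num.sqrt 2 * sin u) ^+ 2 * (pi^-1 * (2 * cos u ^+ 2)).
have cf : continuous f.
  by rewrite /f; continuity.
have dF (u : R) : is_derive u 1 F (f u).
  rewrite /F; apply: is_derive_eq.
  rewrite /f /GRing.scale/= exprMn sqr_sqrtr//.
  transitivity (pi^-1 * (2^-1 + 2 * sin u ^+ 2 * cos u ^+ 2
    - 2^-1 * (1 - 2 * sin u ^+ 2) * (cos u ^+ 2 - sin u ^+ 2))).
    by move: (pi : R) pin0 => p p0; field.
  by rewrite cos2sin2; move: (pi : R) pin0 => p p0; field.
have ab : - (pi / 2) < pi / 2 :> R by lra.
apply: etrans (FTC2_continuous ab cf dF) _.
rewrite /F sinN cosN cos_pihalf !(mulr0, mul0r) !subr0; congr EFin.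
by move: (pi : R) pin0 => p p0; field.
Qed.

(* Rescaled Chebyshev polynomials of the second kind [U_(n-1) (t / sqrt 2)]. *)
Fixpoint cheb (n : nat) (t : R) : R :=
  match n with
  | 0 => 0
  | 1 => 1
  | (n'.+1 as m).+1 => Num.sqrt 2 * t * cheb m t - cheb n' t
  end.

Lemma chebSS n t : cheb n.+2 t = Num.sqrt 2 * t * cheb n.+1 t - cheb n t.
Proof. by []. Qed.

Lemma continuous_cheb n : continuous (cheb n).
Proof.
suff [] : continuous (cheb n) /\ continuous (cheb n.+1) by [].
elim: n => [|n [ih0 ih1]]; first by split; exact: continuous_cstr.
split => //; have -> : cheb n.+2 = fun t => Num.sqrt 2 * t * cheb n.+1 t - cheb n t.
  by apply/funext => t; rewrite chebSS.
by continuity.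
Qed.

(** The classical identity U_(n-1)(cos h) sin h = sin (n h) for h = [pi / 2 - v]; the complementary
    angle appears because the semicircle is parametrised by a sine. *)
Lemma cheb_sin n v :
  cheb n (Num.sqrt 2 * sin v) * cos v = sin (n%:R * (pi / 2 - v)).
Proof.
suff [] : (cheb n (Num.sqrt 2 * sin v) * cos v = sin (n%:R * (pi / 2 - v))) /\
  (cheb n.+1 (Num.sqrt 2 * sin v) * cos v = sin (n.+1%:R * (pi / 2 - v))) by [].
have cE : cos (pi / 2 - v) = sin v.
  by rewrite cosB cos_pihalf sin_pihalf mul0r add0r mul1r.
have sE : sin (pi / 2 - v) = cos v.
  by rewrite sinB cos_pihalf sin_pihalf mul0r subr0 mul1r.
elim: n => [|n [ih0 ih1]].
  by rewrite /= mul0r mul1r mul0r sin0 mul1r sE.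
split => //; rewrite chebSS mulrBl ih0 -(mulrA _ (cheb _ _)) ih1.
rewrite (mulrA (Num.sqrt 2)) -expr2 sqr_sqrtr// -cE.
move: (pi / 2 - v) => p.
have -> : n.+2%:R * p = n.+1%:R * p + p by rewrite -addn1 natrD mulrDl mul1r.
have -> : n%:R * p = n.+1%:R * p - p by rewrite -(addn1 n) natrD mulrDl mul1r addrK.
by rewrite sinB sinD; ring.
Qed.

Lemma sin_natpi n : sin (n%:R * pi) = 0 :> R.
Proof.
elim: n => [|n ih]; first by rewrite mul0r sin0.
by rewrite -addn1 natrD mulrDl mul1r sinD ih sinpi mul0r mulr0 addr0.
Qed.

(** Orthogonality of U_n to U_0 = 1. By [cheb_sin] the integrand is a difference of cosines of two
    consecutive frequencies of equal parity, whose primitive is made of sines vanishing at both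
    ends. For [n = 0] one frequency is 0, and the integral is the total mass instead. *)
Lemma integral_cheb n :
  (\int[sc]_x (cheb n.+1 x)%:E = ((n == 0%N)%:R : R)%:E)%E.
Proof.
case: n => [|n].
  rewrite (eq_integral (cst 1%E))// integral_cst//.
  by rewrite mul1e; exact: probability_setT.
rewrite integral_semicircle_sin; last exact: continuous_cheb.
have pi0 : 0 < pi :> R by exact: pi_gt0.
have pin0 : pi != 0 :> R by rewrite gt_eqF.
have ab : - (pi / 2) < pi / 2 :> R by lra.
pose f (u : R) : R := cheb n.+2 (Num.sqrt 2 * sin u) * (pi^-1 * (2 * cos u ^+ 2)).
have cf : continuous f.
  rewrite /f; continuity.
  move=> u; apply: (continuous_comp (f := fun u : R => Num.sqrt 2 * sin u));
    last exact: continuous_cheb.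
  by apply: continuous_mulr; [exact: continuous_cstr|exact: continuous_sin].
pose F (u : R) : R := - pi^-1 * (sin (n.+1%:R * (pi / 2 - u)) / n.+1%:R
  - sin (n.+3%:R * (pi / 2 - u)) / n.+3%:R).
have dF (u : R) : is_derive u 1 F (f u).
  rewrite /F; apply: is_derive_eq.
  rewrite /GRing.scale/=.
  have -> : f u = pi^-1 * (2 * (sin (n.+2%:R * (pi / 2 - u)) * sin (pi / 2 - u))).
    rewrite /f -cheb_sin; rewrite sinB cos_pihalf sin_pihalf; ring.
  move: (pi / 2 - u) => p.
  have -> : n.+3%:R * p = n.+2%:R * p + p by rewrite -addn1 natrD mulrDl mul1r.
  have -> : n.+1%:R * p = n.+2%:R * p - p by rewrite -(addn1 n.+1) natrD mulrDl mul1r addrK.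
  rewrite cosB cosD.
  have : n.+1%:R != 0 :> R by rewrite pnatr_eq0.
  have : n.+3%:R != 0 :> R by rewrite pnatr_eq0.
  move: (pi : R) pin0 (n.+1%:R : R) (n.+3%:R : R) => q q0 a b b0 a0.
  by field; rewrite q0 a0 b0.
apply: etrans (FTC2_continuous ab cf dF) _.
rewrite /F subrr !mulr0 sin0 opprK -splitr !sin_natpi.
by rewrite !(mul0r, mulr0, subrr).
Qed.

End semicircle_moments.

(** * Hilbert transform of the semicircle law *)

Section hilbert_kernel.
Variable R : realType.
Local Notation sc := (@semicircle R).
Local Notation D := `](- Num.sqrt 2), (Num.sqrt 2)[%classic.
Local Notation cheb := (@cheb R).
Implicit Types q s t x y : R.

Lemma semicircle_suppP t : D t -> t ^+ 2 < 2.
Proof.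
rewrite /= in_itv/= => /andP[t1 t2].
rewrite -[ltRHS](sqr_sqrtr (ler0n R 2)) -real_normK ?num_real//.
by rewrite ltr_pXn2r ?nnegrE ?sqrtr_ge0// ltr_norml t1.
Qed.

Lemma semicircle_suppN : sc (~` D) = 0%E.
Proof. by rewrite /semicircle setICl integral_set0. Qed.

Lemma cheb_le t n : t ^+ 2 <= 2 -> `|cheb n t| <= n%:R.
Proof.
move=> t2.
have s2 : Num.sqrt 2 ^+ 2 = 2 :> R by rewrite sqr_sqrtr.
(* With x = t / sqrt 2 this is the Pell identity T_m^2 + (1 - x^2) U_(m-1)^2 = 1, where T_m = U_m -
   x U_(m-1). It gives |T_m| <= 1, and U_m = T_m + x U_(m-1) then grows by at most 1 per step. Being
   algebraic, it includes the end points, where [cheb_sin] degenerates. *)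
have inv m : (cheb m.+1 t - Num.sqrt 2 * t / 2 * cheb m t) ^+ 2
    + (1 - t ^+ 2 / 2) * cheb m t ^+ 2 = 1.
  elim: m => [|m ih]; first by rewrite /=; ring.
  rewrite -[RHS]ih chebSS; move: (cheb m.+1 t) (cheb m t) => a b.
  move: (Num.sqrt 2) s2 => r s2.
  transitivity (a ^+ 2 + b ^+ 2 - r * t * a * b + (r ^+ 2 / 4 - 2^-1) * t ^+ 2 * a ^+ 2).
    by field.
  transitivity (a ^+ 2 + b ^+ 2 - r * t * a * b + (r ^+ 2 / 4 - 2^-1) * t ^+ 2 * b ^+ 2).
    by rewrite s2; field.
  by field.
elim: n => [|n ih]; first by rewrite normr0.
have c1 : `|cheb n.+1 t - Num.sqrt 2 * t / 2 * cheb n t| <= 1.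
  rewrite -(@ler_pXn2r _ 2)// ?nnegrE// expr1n real_normK ?num_real//.
  rewrite -[leRHS](inv n) lerDl mulr_ge0 ?sqr_ge0//; lra.
have c2 : `|Num.sqrt 2 * t / 2| <= 1.
  rewrite -(@ler_pXn2r _ 2)// ?nnegrE// expr1n real_normK ?num_real//.
  by rewrite !exprMn s2; lra.
rewrite -[cheb n.+1 t](subrK (Num.sqrt 2 * t / 2 * cheb n t)).
rewrite (le_trans (ler_normD _ _))// -addn1 addnC natrD lerD// normrM.
by rewrite (le_trans _ ih)// ler_piMl.
Qed.

(** For s = sqrt 2 cos a and t = sqrt 2 cos b this is the product of the Poisson denominators 1 - 2
    q cos (a + b) + q^2 and 1 - 2 q cos (a - b) + q^2. The form chosen shows its positivity on the
    support and its value [2 * (s - t) ^+ 2] at [q = 1]. *)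
Definition kerQ q s t : R :=
  (1 - q) ^+ 2 * ((1 + q) ^+ 2 - 2 * q * s * t) + 2 * q ^+ 2 * (s - t) ^+ 2.

(* Abel regularisation of the Cauchy kernel [1 / (s - t)]. *)
Definition abel_cauchy q s t : R := q * (1 + q) * (s - t) / kerQ q s t.

(** Since [s * t <= 2], the bracket is at least [(1 + q) ^+ 2 - 4 * q], which is [(1 - q) ^+ 2]. *)
Lemma kerQ_ge q s t : 0 <= q -> s ^+ 2 <= 2 -> t ^+ 2 <= 2 ->
  (1 - q) ^+ 4 <= kerQ q s t.
Proof.
move=> q0 s2 t2; rewrite /kerQ.
have st : s * t <= 2 by nra.
have -> : (1 - q) ^+ 4 = (1 - q) ^+ 2 * (1 - q) ^+ 2 by ring.
apply: (@le_trans _ _ ((1 - q) ^+ 2 * ((1 + q) ^+ 2 - 2 * q * s * t))).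
  by rewrite ler_wpM2l ?sqr_ge0//; nra.
by rewrite lerDl mulr_ge0 ?sqr_ge0// mulr_ge0 ?sqr_ge0.
Qed.

(** An exact partial sum of the generating function, remainder included. The remainder is bilinear
    in the last two Chebyshev values at [s] and [t], so the three-term recurrence turns the
    induction step into a ring identity. *)
Lemma cheb_telescope q s t N :
  let x := Num.sqrt 2 * s in let y := Num.sqrt 2 * t in
  let c := (1 - q) * ((1 + q) ^+ 2 - q * x * y) in
  kerQ q s t * (\sum_(0 <= n < N) q ^+ n.+1 *
    (cheb n.+2 s * cheb n.+1 t - cheb n.+1 s * cheb n.+2 t)) =
  q * (1 + q) * (x - y) - q ^+ N.+1 * (
    (1 + q) * (x - y) * (cheb N.+1 s * cheb N.+1 t)
    + (c - q * x * (x - y)) * (cheb N.+1 s * cheb N t)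
    + (- c - q * y * (x - y)) * (cheb N s * cheb N.+1 t)
    + q * (1 + q) * (x - y) * (cheb N s * cheb N t)).
Proof.
move=> x y c.
have -> : kerQ q s t = (1 - q) ^+ 2 * ((1 + q) ^+ 2 - q * x * y) + q ^+ 2 * (x - y) ^+ 2.
  have s2 : Num.sqrt 2 ^+ 2 = 2 :> R by rewrite sqr_sqrtr.
  by rewrite /kerQ /x /y; move: (Num.sqrt 2) s2 => r <-; ring.
elim: N => [|N ih]; first by rewrite big_geq// /=; ring.
rewrite big_nat_recr//= mulrDr ih /c.
rewrite -/(cheb N.+1 s) -/(cheb N.+1 t) -/x -/y.
set a := cheb N.+1 s; set b := cheb N.+1 t.
set a' := cheb N s; set b' := cheb N t.
rewrite !exprS; ring.
Qed.

Lemma abel_cauchy_approx q s t N : 0 <= q < 1 -> s ^+ 2 <= 2 -> t ^+ 2 <= 2 ->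
  `|abel_cauchy q s t - (Num.sqrt 2)^-1 * \sum_(0 <= n < N) q ^+ n.+1 *
    (cheb n.+2 s * cheb n.+1 t - cheb n.+1 s * cheb n.+2 t)| <=
  48 / (1 - q) ^+ 4 * (q ^+ N.+1 * N.+1%:R ^+ 2).
Proof.
move=> /andP[q0 q1] s2 t2.
have Q0 : 0 < (1 - q) ^+ 4 by rewrite exprn_gt0// subr_gt0.
have Qge := kerQ_ge q0 s2 t2.
have Qgt : 0 < kerQ q s t by exact: lt_le_trans Qge.
have r2 : Num.sqrt 2 ^+ 2 = 2 :> R by rewrite sqr_sqrtr.
have r1 : 1 <= Num.sqrt 2 :> R.
  by rewrite -[leLHS]sqrtr1 ler_sqrt// ler1n.
have := cheb_telescope q s t N.
set x := Num.sqrt 2 * s; set y := Num.sqrt 2 * t; cbv zeta.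
set S := \sum_(0 <= n < N) _; set E := (X in _ - q ^+ N.+1 * X) => eqS.
have -> : abel_cauchy q s t - (Num.sqrt 2)^-1 * S =
    (Num.sqrt 2)^-1 * (q ^+ N.+1 * E) / kerQ q s t.
  have -> : q ^+ N.+1 * E = q * (1 + q) * (x - y) - kerQ q s t * S.
    by rewrite eqS; ring.
  rewrite /abel_cauchy /x /y; field.
  by rewrite !gt_eqF// (lt_le_trans _ r1).
(* The four coefficients of the remainder are at most 8, 16, 16 and 8, because [x] and [y] are at
   most 2 in absolute value; each Chebyshev value is at most [N.+1]. *)
have Ele : `|E| <= 48 * N.+1%:R ^+ 2.
  have x2 : `|x| <= 2.
    rewrite -(@ler_pXn2r _ 2)// ?nnegrE// real_normK ?num_real// exprMn r2; lra.
  have y2 : `|y| <= 2.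
    rewrite -(@ler_pXn2r _ 2)// ?nnegrE// real_normK ?num_real// exprMn r2; lra.
  have le1 n : (n <= N.+1)%N -> `|cheb n s| <= N.+1%:R /\ `|cheb n t| <= N.+1%:R.
    by move=> nN; split; rewrite (le_trans (cheb_le _ _))// ler_nat.
  have [[a1 b1] [a0 b0]] := (le1 _ (leqnn N.+1), le1 _ (leqnSn N)).
  have prod (u v w k : R) : `|u| <= N.+1%:R -> `|v| <= N.+1%:R -> `|w| <= k ->
      `|w * (u * v)| <= k * N.+1%:R ^+ 2.
    by move=> u1 v1 wk; rewrite !normrM expr2 ler_pM// ler_pM.
  have -> : 48 * N.+1%:R ^+ 2 = 8 * N.+1%:R ^+ 2 + 16 * N.+1%:R ^+ 2
    + 16 * N.+1%:R ^+ 2 + 8 * N.+1%:R ^+ 2 :> R by ring.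
  rewrite /E.
  have xy4 : `|x - y| <= 4.
    by rewrite (le_trans (ler_normB _ _))// (_ : 4 = 2 + 2) ?lerD//; ring.
  have q1' : `|q| <= 1 by rewrite ger0_norm// ltW.
  have q2 : `|1 + q| <= 2 by rewrite ger0_norm; lra.
  have ab : `|(1 + q) * (x - y)| <= 8.
    by rewrite normrM (_ : 8 = 2 * 4) ?ler_pM//; ring.
  have ab' : `|q * (1 + q) * (x - y)| <= 8.
    by rewrite -mulrA normrM -[leRHS]mul1r ler_pM.
  have xb : `|q * x * (x - y)| <= 8.
    by rewrite -mulrA normrM -[leRHS]mul1r ler_pM// normrM (_ : 8 = 2 * 4) ?ler_pM//; ring.
  have yb : `|q * y * (x - y)| <= 8.
    by rewrite -mulrA normrM -[leRHS]mul1r ler_pM// normrM (_ : 8 = 2 * 4) ?ler_pM//; ring.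
  have cb : `|(1 - q) * ((1 + q) ^+ 2 - q * x * y)| <= 8.
    rewrite normrM -[leRHS]mul1r ler_pM//; first by rewrite ger0_norm; lra.
    rewrite (le_trans (ler_normB _ _))// (_ : 8 = 4 + 4); last by ring.
    rewrite lerD//; last first.
      rewrite -mulrA normrM -[leRHS]mul1r ler_pM// normrM (_ : 4 = 2 * 2) ?ler_pM//; ring.
    by rewrite normrX (_ : 4 = 2 ^+ 2) ?lerXn2r ?nnegrE//; ring.
  have e16 : 16 = 8 + 8 :> R by ring.
  rewrite (le_trans (ler_normD _ _))// lerD//; last exact: prod.
  rewrite (le_trans (ler_normD _ _))// lerD//; last first.
    by apply: prod => //; rewrite e16 (le_trans (ler_normB _ _))// normrN lerD.
  rewrite (le_trans (ler_normD _ _))// lerD//; first exact: prod.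
  by apply: prod => //; rewrite e16 (le_trans (ler_normB _ _))// lerD.
rewrite !normrM !normfV (gtr0_norm Qgt) (gtr0_norm (lt_le_trans ltr01 r1)).
rewrite ger0_norm ?exprn_ge0//.
set X := q ^+ N.+1.
have -> : 48 / (1 - q) ^+ 4 * (X * N.+1%:R ^+ 2) =
  1 * (X * (48 * N.+1%:R ^+ 2)) * ((1 - q) ^+ 4)^-1 by ring.
have r0 : 0 <= (Num.sqrt 2 : R)^-1 by rewrite invr_ge0 sqrtr_ge0.
have r1' : (Num.sqrt 2 : R)^-1 <= 1 by rewrite invf_le1// (lt_le_trans ltr01 r1).
have X0 : 0 <= X by rewrite exprn_ge0.
have XE : X * `|E| <= X * (48 * N.+1%:R ^+ 2) by rewrite ler_wpM2l.
have Qi : (kerQ q s t)^-1 <= ((1 - q) ^+ 4)^-1 by rewrite lef_pV2 ?posrE.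
apply: ler_pM => //; first by rewrite !mulr_ge0.
- by rewrite invr_ge0 ltW.
- by apply: ler_pM => //; rewrite mulr_ge0.
Qed.

End hilbert_kernel.

(** * Integration of the regularised Cauchy kernel *)

Section hilbert_transform.
Variable R : realType.
Local Notation sc := (@semicircle R).
Local Notation D := `](- Num.sqrt 2), (Num.sqrt 2)[%classic.
Local Notation cheb := (@cheb R).
Implicit Types p q s t x y : R.

Lemma natX_bound p n : 0 <= p < 1 -> n%:R * p ^+ n <= (1 - p)^-1.
Proof.
move=> /andP[p0 p1]; have p1' : 0 < 1 - p by rewrite subr_gt0.
rewrite -[leRHS]mul1r ler_pdivlMr//.
(* The right-hand side is [1 - p] times a sum of [n] powers of [p], each at least [p ^+ n]. *)
suff : n%:R * p ^+ n * (1 - p) <= 1 - p ^+ n.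
  by move=> /le_trans; apply; rewrite lerBlDr lerDl exprn_ge0.
elim: n => [|n ih]; first by rewrite !mul0r expr0 subrr.
have pn1 : p ^+ n.+1 <= 1 by rewrite exprn_ile1// ltW.
have pn0 : 0 <= p ^+ n by rewrite exprn_ge0.
move: ih pn1; rewrite exprS -addn1 natrD.
move: (n%:R) (p ^+ n) pn0 => a b b0 ih pn1.
nra.
Qed.

Lemma integrable_bounded_supp (f : R -> R) M : measurable_fun setT f ->
  (forall t, D t -> `|f t| <= M) -> sc.-integrable D (EFin \o f).
Proof.
move=> mf fM; apply: measurable_bounded_integrable => //.
- by rewrite (le_lt_trans (probability_le1 _ _))// ltry.
- exact: measurable_funTS.
- exists M; split; first exact: num_real.
  by move=> x Mx t /= Dt; rewrite (le_trans (fM _ Dt))// ltW.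
Qed.

Lemma integral_supp (f : R -> \bar R) : measurable_fun setT f ->
  (\int[sc]_(x in D) f x = \int[sc]_x f x)%E.
Proof.
move=> mf; rewrite integral_mkcond; apply: ae_eq_integral => //.
  by apply/(measurable_restrictT _ _).1 => //; exact: measurable_funTS.
exists (~` D); split => //; first exact: measurableC.
  exact: semicircle_suppN.
move=> t /= tD Dt; apply: tD => _.
by rewrite patchE mem_set.
Qed.

Lemma integrable_cheb n : sc.-integrable D (EFin \o cheb n).
Proof.
apply: (@integrable_bounded_supp _ n%:R).
  by apply: continuous_measurable_fun; exact: continuous_cheb.
by move=> t Dt; apply: cheb_le; exact/ltW/semicircle_suppP.
Qed.

Lemma integral_cheb_supp n :
  (\int[sc]_(x in D) (cheb n.+1 x)%:E = ((n == 0%N)%:R : R)%:E)%E.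
Proof.
rewrite integral_supp ?integral_cheb//.
by apply/measurable_EFinP; apply: continuous_measurable_fun; exact: continuous_cheb.
Qed.

(** Among the polynomials in [t] only U_0 has a nonzero mean, so a single coefficient survives,
    [q * cheb 2 s], which is linear in [s]. This is why the Hilbert transform is the identity on the
    support. *)
Lemma integral_cheb_sum q s N : let P t := \sum_(0 <= n < N) q ^+ n.+1 *
    (cheb n.+2 s * cheb n.+1 t - cheb n.+1 s * cheb n.+2 t) in
  sc.-integrable D (EFin \o P) /\
  (\int[sc]_(t in D) (P t)%:E = ((0 < N)%N%:R * (q * Num.sqrt 2 * s))%:E)%E.
Proof.
have mD : measurable (D : set (measurableTypeR R)) by [].
elim: N => [|N [ih1 ih2]] P.
  have -> : P = cst 0 by apply/funext => t; rewrite /P big_geq.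
  by split; [exact: integrable0|rewrite integral0 mul0r].
pose P' t := \sum_(0 <= n < N) q ^+ n.+1 *
    (cheb n.+2 s * cheb n.+1 t - cheb n.+1 s * cheb n.+2 t).
have PE : P = (fun t => P' t + (q ^+ N.+1 * cheb N.+2 s * cheb N.+1 t
    + - (q ^+ N.+1 * cheb N.+1 s) * cheb N.+2 t)).
  by apply/funext => t; rewrite /P big_nat_recr//=; congr (_ + _); rewrite mulrBr mulNr !mulrA.
have iZ c n : sc.-integrable D (EFin \o (fun t => c * cheb n t)).
  exact: (integrableZl mD c (integrable_cheb n)).
have iD c c' n n' : sc.-integrable D (EFin \o (fun t => c * cheb n t + c' * cheb n' t)).
  exact: (integrableD mD (iZ c n) (iZ c' n')).
have EZ c n : (\int[sc]_(t in D) (c * cheb n.+1 t)%:E = (c * (n == 0%N)%:R)%:E)%E.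
  under eq_integral do rewrite EFinM.
  by rewrite integralZl ?integral_cheb_supp//; exact: integrable_cheb.
have ED c c' n n' : (\int[sc]_(t in D) (c * cheb n.+1 t + c' * cheb n'.+1 t)%:E =
    (c * (n == 0%N)%:R + c' * (n' == 0%N)%:R)%:E)%E.
  under eq_integral do rewrite EFinD.
  rewrite (integralD mD (iZ c n.+1) (iZ c' n'.+1)).
  by rewrite [X in (X + _)%E]EZ [X in (_ + X)%E]EZ.
rewrite PE; split.
  exact: (integrableD mD ih1 (iD _ _ _ _)).
under eq_integral do rewrite EFinD.
rewrite (integralD mD ih1 (iD _ _ N.+1 N.+2)) [X in (X + _)%E]ih2 [X in (_ + X)%E]ED.
rewrite -EFinD; congr EFin.
case: N {ih1 ih2 P P' PE} => [|N]; last by rewrite !(mulr0, addr0).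
by rewrite !(mul0r, mulr0, addr0, add0r, mulr1, mul1r, expr1) /= mulr1 subr0 mulrA.
Qed.

Lemma measurable_abel_cauchy q :
  measurable_fun setT (fun z : measurableTypeR R * measurableTypeR R => abel_cauchy q z.1 z.2).
Proof.
rewrite /abel_cauchy /kerQ; apply: measurable_funM.
  by apply: measurable_funM => //; apply: measurable_funB.
apply: measurable_funV; apply: measurable_funD; apply: measurable_funM => //.
- apply: measurable_funB => //; apply: measurable_funM => //.
  by apply: measurable_funM.
- by apply: measurable_funX; apply: measurable_funB.
Qed.

Lemma abel_cauchy_le q s t : 0 <= q < 1 -> s ^+ 2 <= 2 -> t ^+ 2 <= 2 ->
  `|abel_cauchy q s t| <= 8 / (1 - q) ^+ 4.
Proof.
move=> /andP[q0 q1] s2 t2.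
have Q0 : 0 < (1 - q) ^+ 4 by rewrite exprn_gt0// subr_gt0.
have Qge := kerQ_ge q0 s2 t2.
have Qgt : 0 < kerQ q s t by exact: lt_le_trans Qge.
rewrite /abel_cauchy normrM normfV (gtr0_norm Qgt).
apply: ler_pM => //; first by rewrite invr_ge0 ltW.
  rewrite normrM (_ : 8 = 2 * 4); last by ring.
  have [s1 s1'] : -2 <= s /\ s <= 2 by split; nra.
  have [t1 t1'] : -2 <= t /\ t <= 2 by split; nra.
  apply: ler_pM => //; rewrite ler_norml; apply/andP; split; nra.
by rewrite lef_pV2 ?posrE.
Qed.

(* The parameter is a cube so that the factor [N.+1%:R ^+ 2] of
   [abel_cauchy_approx] can be absorbed by two of the three powers of [p]. *)
Lemma integral_abel_cauchy p t : 0 < p < 1 -> D t ->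
  (\int[sc]_(s in D) (abel_cauchy (p ^+ 3) t s)%:E = (p ^+ 3 * t)%:E)%E.
Proof.
move=> /andP[p0 p1] Dt; set q := p ^+ 3.
have t2 : t ^+ 2 <= 2 by exact/ltW/semicircle_suppP.
have q0 : 0 <= q by rewrite exprn_ge0// ltW.
have q1 : q < 1 by rewrite exprn_ilt1// ltW.
have q01 : 0 <= q < 1 by rewrite q0.
have mk : measurable_fun setT (abel_cauchy q t).
  have := measurable_fun_pair2 t (@measurable_abel_cauchy q).
  exact.
have ik : sc.-integrable D (EFin \o abel_cauchy q t).
  apply: (@integrable_bounded_supp _ (8 / (1 - q) ^+ 4)) => // s Ds.
  by apply: abel_cauchy_le => //; exact/ltW/semicircle_suppP.
rewrite -[LHS]fineK ?integrable_fin_num//; congr EFin.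
set I := fine _.
pose C := 48 / (1 - q) ^+ 4 * ((1 - p)^-1) ^+ 2.
have C0 : 0 <= C.
  by rewrite mulr_ge0 ?sqr_ge0// mulr_ge0// invr_ge0 exprn_ge0// subr_ge0 ltW.
suff bound n : `|I - q * t| <= C * p ^+ n.
  apply/eqP; rewrite -subr_eq0 -normr_le0.
  have cvC : (fun n => C * p ^+ n) @ \oo --> (0 : R).
    rewrite -(mulr0 C); apply: cvgM; first exact: cvg_cst.
    by apply: cvg_expr; rewrite gtr0_norm.
  by apply: (cvgr_to_ge cvC); exact: nearW.
pose N := n.+1.
have [iP EP] := integral_cheb_sum q t N.
set P := (X in EFin \o X) in iP EP.
have mD : measurable (D : set (measurableTypeR R)) by [].
pose c : R := (Num.sqrt 2)^-1.
have r0 : Num.sqrt 2 != 0 :> R by rewrite gt_eqF// sqrtr_gt0.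
have icP : sc.-integrable D (EFin \o (fun s => c * P s)) := integrableZl mD c iP.
have qt : (\int[sc]_(s in D) (c * P s)%:E)%E = (q * t)%:E.
  under eq_integral do rewrite EFinM.
  rewrite (integralZl mD iP) EP mul1r -EFinM; congr EFin.
  by rewrite /c -mulrA mulrCA (mulrA _^-1) mulVf// mul1r.
have iB := integrableB mD ik icP.
have -> : I - q * t = fine (\int[sc]_(s in D) (abel_cauchy q t s - c * P s)%:E)%E.
  under eq_integral do rewrite EFinB.
  rewrite (integralB mD ik icP) fineB ?integrable_fin_num//.
  by rewrite [X in _ - fine X]qt.
pose B := 48 / (1 - q) ^+ 4 * (q ^+ N.+1 * N.+1%:R ^+ 2).
have BC : B <= C * p ^+ n.
  rewrite /B /C -[leRHS]mulrA ler_wpM2l//.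
    by rewrite mulr_ge0// invr_ge0 exprn_ge0// subr_ge0 ltW.
  have -> : q ^+ N.+1 * N.+1%:R ^+ 2 = (N.+1%:R * p ^+ N.+1) ^+ 2 * p ^+ N.+1.
    by rewrite /q -exprM mulnC exprM; ring.
  have pN : 0 <= p ^+ N.+1 by rewrite exprn_ge0// ltW.
  have h0 : 0 <= N.+1%:R * p ^+ N.+1 by rewrite mulr_ge0.
  have hp : 0 <= (1 - p)^-1 by rewrite invr_ge0 subr_ge0 ltW.
  have h : N.+1%:R * p ^+ N.+1 <= (1 - p)^-1 by apply: natX_bound; rewrite (ltW p0) p1.
  apply: ler_pM => //; first exact: sqr_ge0.
    by rewrite ler_pXn2r ?nnegrE.
  have nN : (n <= N.+1)%N by rewrite /N ltnW.
  exact: (ler_wiXn2l (ltW p0) (ltW p1) nN).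
apply: le_trans BC.
rewrite -lee_fin -fine_abse ?integrable_fin_num// fineK; last first.
  by rewrite abse_fin_num integrable_fin_num.
have B0 : 0 <= B.
  apply: mulr_ge0; last by rewrite mulr_ge0 ?sqr_ge0// exprn_ge0.
  by rewrite mulr_ge0// invr_ge0 exprn_ge0// subr_ge0 ltW.
apply: le_trans (le_abse_integral _ _ _) _ => //.
  exact: (measurable_int _ iB).
have := @integral_le_bound _ _ _ sc D (fun s => (abel_cauchy q t s - c * P s)%:E) B%:E mD.
move=> /(_ (measurable_int _ iB)); rewrite lee_fin => /(_ B0) h.
apply: le_trans (h _) _.
  apply: aeW => s Ds; rewrite /= lee_fin.
  by apply: abel_cauchy_approx => //; exact/ltW/semicircle_suppP.
by rewrite -[leRHS]mule1 lee_wpmul2l ?lee_fin// probability_le1.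
Qed.

End hilbert_transform.

(** * Difference quotients of monotone functions *)

Section difference_quotient.
Variable R : realType.
Local Notation sc := (@semicircle R).
Local Notation D := (`](- Num.sqrt 2), (Num.sqrt 2)[%classic : set R).
Implicit Types p q s t x y : R.

(** The indicators make the kernel bounded on the whole plane for fixed [p], so that Fubini applies
    to its product with any integrable function of one variable. *)
Let Kr p (z : plane R) : R := \1_D z.1 * \1_D z.2 * abel_cauchy (p ^+ 3) z.1 z.2.

Let KrN p t s : Kr p (t, s) = - Kr p (s, t).
Proof.
rewrite /Kr /= [\1_D s * _]mulrC -mulrN; congr (_ * _).
have -> : abel_cauchy (p ^+ 3) t s = - abel_cauchy (p ^+ 3) s t; last by [].
rewrite /abel_cauchy -mulNr -mulrN opprB; congr (_ / _).
by rewrite /kerQ; ring.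
Qed.

Let measurable_Kr p : measurable_fun setT (Kr p).
Proof.
have mD : measurable (D : set (measurableTypeR R)) by [].
apply: measurable_funM; last exact: measurable_abel_cauchy.
have mI : measurable_fun setT (\1_D : measurableTypeR R -> R).
  exact: measurable_indic.
apply: measurable_funM; first exact: (measurableT_comp mI measurable_fst).
exact: (measurableT_comp mI measurable_snd).
Qed.

Let Kr_le p z : 0 < p < 1 -> `|Kr p z| <= 8 / (1 - p ^+ 3) ^+ 4.
Proof.
move=> /andP[p0 p1].
have q1 : p ^+ 3 < 1 by rewrite exprn_ilt1// ltW.
have q0 : 0 <= p ^+ 3 by rewrite exprn_ge0// ltW.
have B0 : 0 <= 8 / (1 - p ^+ 3) ^+ 4.
  by rewrite mulr_ge0// invr_ge0 exprn_ge0// subr_ge0 ltW.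
rewrite /Kr !indicE.
have [z1|] := boolP (z.1 \in D); last by rewrite !mul0r normr0.
have [z2|] := boolP (z.2 \in D); last by rewrite mulr0 mul0r normr0.
rewrite !mul1r; apply: abel_cauchy_le; first by rewrite q0.
- by apply/ltW/semicircle_suppP; rewrite -inE.
- by apply/ltW/semicircle_suppP; rewrite -inE.
Qed.

Let integral_Kr p t : 0 < p < 1 ->
  (\int[sc]_s (Kr p (t, s))%:E = (\1_D t * (p ^+ 3 * t))%:E)%E.
Proof.
move=> p01; rewrite /Kr /= indicE.
have [Dt|] := boolP (t \in D); last first.
  by under eq_integral do rewrite !mul0r; rewrite integral0 mul0r.
rewrite mul1r -(integral_abel_cauchy p01 (set_mem Dt)) [RHS]integral_mkcond.
apply: eq_integral => s _; rewrite patchE indicE !mul1r.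
by case: ifPn; rewrite ?mul1r ?mul0r.
Qed.

Section integral_Kr_mul.
Variables (p : R) (g : R -> R).
Hypothesis p01 : 0 < p < 1.
Hypothesis ig : sc.-integrable setT (EFin \o g).

Let mg : measurable_fun setT g.
Proof. by apply/measurable_EFinP; exact: measurable_int ig. Qed.

Let M := 8 / (1 - p ^+ 3) ^+ 4.

Let M0 : 0 <= M.
Proof. by rewrite (le_trans _ (Kr_le (0, 0) p01)). Qed.

Let mKg1 : measurable_fun setT (fun z : plane R => (Kr p z * g z.1)%:E).
Proof.
apply/measurable_EFinP; apply: measurable_funM => //.
exact: (measurableT_comp mg).
Qed.

Let mKg2 : measurable_fun setT (fun z : plane R => (Kr p z * g z.2)%:E).
Proof.
apply/measurable_EFinP; apply: measurable_funM => //.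
exact: (measurableT_comp mg).
Qed.

Let int_g_lty : (\int[sc]_t `|(g t)%:E| < +oo)%E.
Proof. by case/integrableP : ig. Qed.

Let inner t (h : R -> R) : measurable_fun setT h -> (forall s, `|h s| <= M * `|g t|) ->
  (\int[sc]_s `|(h s)%:E| <= M%:E * `|(g t)%:E|)%E.
Proof.
move=> mh hM.
have c0 : (0 <= M%:E * `|(g t)%:E|)%E by rewrite mule_ge0// lee_fin.
apply: le_trans (integral_le_bound (M%:E * `|(g t)%:E|)%E measurableT _ c0 _) _.
- exact/measurable_EFinP.
- by apply: aeW => s _; rewrite /= lee_fin.
- by rewrite -[leRHS]mule1 lee_wpmul2l ?probability_le1.
Qed.

Lemma integrable_Kr1 :
  (sc \x sc)%E.-integrable setT (fun z : plane R => (Kr p z * g z.1)%:E).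
Proof.
apply/integrable12ltyP => //.
apply: (@le_lt_trans _ _ (\int[sc]_t (M%:E * `|(g t)%:E|))%E).
  apply: ge0_le_integral => //.
  - by move=> t _; apply: integral_ge0.
  - apply: (measurable_fun_fubini_tonelli_F (fun z : plane R => `|(Kr p z * g z.1)%:E|)%E) => //.
    exact: measurableT_comp.
  - apply: emeasurable_funM => //; apply: measurableT_comp => //.
    exact/measurable_EFinP.
  - move=> t _; apply: inner => [|s].
      have mK : measurable_fun setT (fun s => Kr p (t, s)).
        exact: (measurable_fun_pair2 t (@measurable_Kr p)).
      exact: (measurable_funM mK (measurable_cst (g t))).
    by rewrite normrM ler_wpM2r// Kr_le.
rewrite ge0_integralZl//; last first.
  by apply: measurableT_comp => //; exact/measurable_EFinP.
by rewrite lte_mul_pinfty// ?lee_fin.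
Qed.

Lemma integrable_Kr2 :
  (sc \x sc)%E.-integrable setT (fun z : plane R => (Kr p z * g z.2)%:E).
Proof.
apply/integrable21ltyP => //.
apply: (@le_lt_trans _ _ (\int[sc]_t (M%:E * `|(g t)%:E|))%E).
  apply: ge0_le_integral => //.
  - by move=> t _; apply: integral_ge0.
  - apply: (measurable_fun_fubini_tonelli_G (fun z : plane R => `|(Kr p z * g z.2)%:E|)%E) => //.
    exact: measurableT_comp.
  - apply: emeasurable_funM => //; apply: measurableT_comp => //.
    exact/measurable_EFinP.
  - move=> t _; apply: inner => [|s].
      have mK : measurable_fun setT (fun s => Kr p (s, t)).
        exact: (measurable_fun_pair1 t (@measurable_Kr p)).
      exact: (measurable_funM mK (measurable_cst (g t))).
    by rewrite normrM ler_wpM2r// Kr_le.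
rewrite ge0_integralZl//; last first.
  by apply: measurableT_comp => //; exact/measurable_EFinP.
by rewrite lte_mul_pinfty// ?lee_fin.
Qed.

Let integrable_KrT (h : R -> R) : measurable_fun setT h ->
  (forall s, `|h s| <= M) -> sc.-integrable setT (EFin \o h).
Proof.
move=> mh hM; apply: measurable_bounded_integrable => //.
  by rewrite (le_lt_trans (probability_le1 _ _))// ltry.
exists M; split; first exact: num_real.
by move=> x Mx t /= _; rewrite (le_trans (hM t))// ltW.
Qed.

Let integrable_mul_id : sc.-integrable setT (fun t => (\1_D t * (g t * t))%:E).
Proof.
have mD : measurable (D : set (measurableTypeR R)) by [].
apply: (le_integrable measurableT _ _ (integrableZl measurableT 2 ig)).
  apply/measurable_EFinP; apply: measurable_funM; first exact: measurable_indic.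
  exact: measurable_funM.
move=> t _; rewrite /= lee_fin indicE.
have [Dt|_] := boolP (t \in D); last by rewrite mul0r normr0.
rewrite mul1r !normrM [leRHS]mulrC ler_wpM2l// (ger0_norm (ler0n _ 2)).
have := semicircle_suppP (set_mem Dt); rewrite -real_normK ?num_real//.
by have := normr_ge0 t; nra.
Qed.

Let integral_mul_id : (\int[sc]_t (g t * t)%:E = \int[sc]_t (\1_D t * (g t * t))%:E)%E.
Proof.
rewrite -integral_supp; last by apply/measurable_EFinP; exact: measurable_funM.
rewrite integral_mkcond; apply: eq_integral => t _.
by rewrite patchE indicE; case: ifPn; rewrite ?mul1r ?mul0r.
Qed.

Lemma integral_mul_id_fin_num : (\int[sc]_t (g t * t)%:E)%E \is a fin_num.
Proof. by rewrite integral_mul_id integrable_fin_num. Qed.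

(** Integrating first in the variable absent from [g] produces the Hilbert transform in each half of
    the difference. The kernel is antisymmetric, so the two halves add up instead of cancelling,
    whence the factor 2. *)
Lemma integral_Kr_diff :
  (\int[sc \x sc]_z (Kr p z * (g z.1 - g z.2))%:E =
   (2 * p ^+ 3)%:E * \int[sc]_t (g t * t)%:E)%E.
Proof.
have E1 : (\int[sc \x sc]_z (Kr p z * g z.1)%:E =
    (p ^+ 3)%:E * \int[sc]_t (g t * t)%:E)%E.
  rewrite -(integral12_prod_meas1 integrable_Kr1) /fubini_F/= integral_mul_id.
  rewrite -integralZl//; apply: eq_integral => t _.
  transitivity (\int[sc]_s ((g t)%:E * (Kr p (t, s))%:E))%E.
    by apply: eq_integral => s _; rewrite -EFinM mulrC.
  rewrite integralZl//.
    by rewrite integral_Kr// -!EFinM; congr EFin; ring.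
  apply: integrable_KrT => [|s]; last exact: Kr_le.
  exact: (measurable_fun_pair2 t (@measurable_Kr p)).
have E2 : (\int[sc \x sc]_z (Kr p z * g z.2)%:E =
    - ((p ^+ 3)%:E * \int[sc]_t (g t * t)%:E))%E.
  rewrite -(integral21_prod_meas1 integrable_Kr2) /fubini_G/= integral_mul_id.
  rewrite -integralZl// -integralN; last first.
    exact: integrable_add_def (integrableZl measurableT _ integrable_mul_id).
  apply: eq_integral => t _.
  transitivity (\int[sc]_s ((- g t)%:E * (Kr p (t, s))%:E))%E.
    apply: eq_integral => s _; rewrite KrN -EFinM; congr EFin; ring.
  rewrite integralZl//.
    by rewrite integral_Kr// -!EFinM -EFinN; congr EFin; ring.
  apply: integrable_KrT => [|s]; last exact: Kr_le.
  exact: (measurable_fun_pair2 t (@measurable_Kr p)).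
transitivity (\int[sc \x sc]_z ((Kr p z * g z.1)%:E - (Kr p z * g z.2)%:E))%E.
  by apply: eq_integral => z _; rewrite -EFinB -mulrBr.
rewrite integralB//; [|exact: integrable_Kr1|exact: integrable_Kr2].
rewrite E1 E2 -(fineK integral_mul_id_fin_num) -!EFinM -EFinN -EFinB.
by congr EFin; ring.
Qed.

End integral_Kr_mul.

(** [harmonic 0] is 1, so the factor [2^-1] keeps [pn 0] positive. *)
Let pn (n : nat) : R := 1 - 2^-1 * harmonic n.

Let pn01 n : 0 < pn n < 1.
Proof.
have h0 : 0 < harmonic n :> R by rewrite /harmonic invr_gt0.
have h1 : harmonic n <= 1 :> R by rewrite /harmonic invf_le1// ler1n.
by rewrite /pn; apply/andP; split; lra.
Qed.

Let cvg_pn : pn @ \oo --> (1 : R).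
Proof.
rewrite -[X in _ --> X]subr0 -(mulr0 2^-1); apply: cvgB; first exact: cvg_cst.
by apply: cvgM; [exact: cvg_cst|exact: cvg_harmonic].
Qed.

Let cvg_pn3 : (fun n => pn n ^+ 3) @ \oo --> (1 : R).
Proof.
rewrite -[X in _ --> X](expr1n R 3).
by apply: (@cvg_comp _ _ _ pn (fun x : R => x ^+ 3) _ _ _ cvg_pn); exact: exprn_continuous.
Qed.

Let cvg_abel_cauchy s t : s != t ->
  (fun n => abel_cauchy (pn n ^+ 3) s t) @ \oo --> (s - t)^-1.
Proof.
move=> st.
have st0 : s - t != 0 by rewrite subr_eq0.
have Q1 : kerQ 1 s t = 2 * (s - t) ^+ 2.
  by rewrite /kerQ subrr expr0n mul0r add0r expr1n mulr1.
have -> : (s - t)^-1 = abel_cauchy 1 s t.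
  by rewrite /abel_cauchy Q1; field.
apply: (@cvg_comp _ _ _ (fun n => pn n ^+ 3) (fun q => abel_cauchy q s t) _ _ _ cvg_pn3).
rewrite /abel_cauchy.
apply: cvgM.
  have c : continuous (fun q : R => q * (1 + q) * (s - t)) by continuity.
  exact: c.
apply: cvgV; first by rewrite Q1 mulf_neq0// expf_neq0.
have c : continuous (fun q : R => kerQ q s t) by rewrite /kerQ; continuity.
exact: c.
Qed.

(** Monotonicity of [g] makes the regularised integrands nonnegative, so Fatou's lemma passes to the
    limit despite the singularity at the diagonal. On the diagonal the regularised integrands
    vanish, in agreement with the value 0 of the quotient [0 / 0]. *)
Lemma le_integral_difference_quotient (g : R -> R) :
  sc.-integrable setT (EFin \o g) ->
  {in D &, {homo g : s t / s <= t}} ->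
  (\int[sc \x sc]_z
     (\1_D z.1 * \1_D z.2 * ((g z.1 - g z.2) / (z.1 - z.2)))%:E <=
   2%:E * \int[sc]_t (g t * t)%:E)%E.
Proof.
move=> ig ndg.
have mg : measurable_fun setT g by apply/measurable_EFinP; exact: measurable_int ig.
pose f n (z : plane R) := (Kr (pn n) z * (g z.1 - g z.2))%:E.
have mf n : measurable_fun setT (f n).
  apply/measurable_EFinP; apply: measurable_funM; first exact: measurable_Kr.
  apply: measurable_funB; first exact: (measurableT_comp mg measurable_fst).
  exact: (measurableT_comp mg measurable_snd).
have f0 n z : setT z -> (0 <= f n z)%E.
  move=> _; rewrite lee_fin /Kr !indicE.
  have [z1|] := boolP (z.1 \in D); last by rewrite !mul0r.
  have [z2|] := boolP (z.2 \in D); last by rewrite mulr0 !mul0r.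
  have /andP[p0 p1] := pn01 n.
  have q0 : 0 <= pn n ^+ 3 by rewrite exprn_ge0// ltW.
  have q1 : pn n ^+ 3 < 1 by rewrite exprn_ilt1// ltW.
  have Qgt : 0 < kerQ (pn n ^+ 3) z.1 z.2.
    apply: lt_le_trans (kerQ_ge q0 _ _); first by rewrite exprn_gt0// subr_gt0.
      exact/ltW/semicircle_suppP/set_mem.
    exact/ltW/semicircle_suppP/set_mem.
  rewrite !mul1r /abel_cauchy mulrAC.
  apply: mulr_ge0; last by rewrite invr_ge0 ltW.
  have q2 : 0 <= pn n ^+ 3 * (1 + pn n ^+ 3) by move: (pn n ^+ 3) q0 => q q0; nra.
  rewrite -[leRHS]mulrA; apply: mulr_ge0; first exact: q2.
  have [le12|/ltW le21] := leP z.1 z.2.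
    by rewrite mulr_le0 ?subr_le0// ndg.
  by rewrite mulr_ge0 ?subr_ge0// ndg.
have fE z : limn_einf (f ^~ z) =
    (\1_D z.1 * \1_D z.2 * ((g z.1 - g z.2) / (z.1 - z.2)))%:E.
  suff cf : f ^~ z @ \oo --> (\1_D z.1 * \1_D z.2 * ((g z.1 - g z.2) / (z.1 - z.2)))%:E.
    by rewrite (cvg_limn_einf_sup cf).1.
  apply: cvg_EFin; first exact: nearW.
  have [z12|z12] := eqVneq z.1 z.2.
    rewrite z12 !subrr mul0r mulr0; apply: cvg_near_cst; apply: nearW => n.
    by rewrite /f /= z12 subrr mulr0.
  rewrite (_ : _ * (_ / _) = \1_D z.1 * \1_D z.2 * (z.1 - z.2)^-1 * (g z.1 - g z.2)); last by ring.
  apply: cvgM; last exact: cvg_cst.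
  by apply: cvgM; [exact: cvg_cst|exact: cvg_abel_cauchy].
under eq_integral do rewrite -fE.
apply: le_trans (fatou _ measurableT mf f0) _.
have cI : (fun n => \int[sc \x sc]_z f n z)%E @ \oo --> (2%:E * \int[sc]_t (g t * t)%:E)%E.
  under eq_fun do rewrite integral_Kr_diff//.
  rewrite -(fineK (integral_mul_id_fin_num ig)); set I := fine _.
  apply: cvg_EFin; first exact: nearW.
  rewrite -[in X in _ --> X](mulr1 2).
  by apply: cvgM; [apply: cvgM; [exact: cvg_cst|exact: cvg_pn3]|exact: cvg_cst].
by rewrite (cvg_limn_einf_sup cI).1.
Qed.

End difference_quotient.

(** * Distribution functions *)

Section cdf_unique.
Variable R : realType.

Lemma eq_measure_cdf (P Q : probability (measurableTypeR R) R) :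
  (forall x : R, P `]-oo, x]%classic = Q `]-oo, x]%classic) ->
  forall A, measurable A -> P A = Q A.
Proof.
move=> PQ; have PQC x : P `]x, +oo[%classic = Q `]x, +oo[%classic.
  by rewrite -setCitvl !probability_setC// PQ.
move=> A mA; apply: (@measure_unique _ R (measurableTypeR R) (@RGenOInfty.G R)
  (fun n => `](- n%:R), +oo[%classic) _ _ _ _ P Q) => //.
- exact: RGenOInfty.measurableE.
- move=> _ _ [x ->] [y ->]; exists (Num.max x y).
  by rewrite predeqE => t /=; rewrite !in_itv/= !andbT gt_max; split => [[-> ->]|/andP].
- by move=> n; eexists; reflexivity.
- rewrite -subTset => t _; exists (Num.truncn `|t|).+1 => //=.
  rewrite in_itv/= andbT ltrNl (le_lt_trans (ler_norm _))// normrN.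
  by rewrite truncnS_gt.
- by move=> _ [x ->]; exact: PQC.
- by move=> n; rewrite (le_lt_trans (probability_le1 _ _))// ltry.
Qed.

End cdf_unique.

Section semicircle_cdf.
Variable R : realType.
Local Notation leb := (@lebesgue_measure R).
Local Notation sc := (@semicircle R).
Local Notation D := (`](- Num.sqrt 2), (Num.sqrt 2)[%classic : set R).
Local Notation r2 := (Num.sqrt 2 : R).

Lemma semicircle_pdf_le1 (t : R) : semicircle_pdf t <= 1.
Proof.
have pi2 : 2 <= pi :> R by exact: pi_ge2.
have pi0 : 0 < pi :> R by exact: pi_gt0.
rewrite /semicircle_pdf mulrC ler_pdivrMr// mul1r (le_trans _ pi2)//.
rewrite -[leRHS]ger0_norm// -sqrtr_sqr ler_sqrt ?sqr_ge0//.
by have := sqr_ge0 t; lra.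
Qed.

(** This comparison makes the distribution function Lipschitz and bounds the mass of small balls,
    from which finite logarithmic energy follows. *)
Lemma semicircle_le_lebesgue A : measurable A -> (sc A <= leb A)%E.
Proof.
move=> mA; have mD : measurable (D : set (measurableTypeR R)) by [].
apply: (@le_trans _ _ (\int[leb]_(t in A `&` D) 1)%E).
  apply: ge0_le_integral => //.
  - exact: measurableI.
  - by move=> t _; rewrite lee_fin semicircle_pdf_ge0.
  - by apply/measurable_EFinP/measurable_funTS; exact: measurable_semicircle_pdf.
  - by move=> t _; rewrite lee_fin semicircle_pdf_le1.
rewrite integral_cst ?mul1e; last exact: measurableI.
by rewrite le_measure ?inE//; exact: measurableI.
Qed.

Lemma semicircle_itv_gt0 (a b : R) : - r2 <= a -> a < b -> b <= r2 ->
  (0 < sc `]a, b]%classic)%E.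
Proof.
move=> ra ab br.
have s2 : 0 < r2 by rewrite sqrtr_gt0.
(* The density vanishes at the ends of the support, so its lower bound is taken on the middle third,
   which stays away from them. *)
pose c := (2 * a + b) / 3; pose d := (a + 2 * b) / 3.
have [ac cd db] : [/\ a < c, c < d & d < b] by rewrite /c /d; split; lra.
pose M := Num.max `|c| `|d|.
have Mr : M < r2.
  by rewrite /M gt_max !ltr_norml; apply/andP; split; apply/andP; split; lra.
pose m := pi^-1 * Num.sqrt (2 - M ^+ 2).
have M2 : 0 < 2 - M ^+ 2.
  rewrite subr_gt0.
  rewrite -[ltRHS](sqr_sqrtr (ler0n R 2)) ltr_pXn2r ?nnegrE ?sqrtr_ge0//.
  by rewrite le_max normr_ge0.
have m0 : 0 < m by rewrite mulr_gt0 ?invr_gt0 ?pi_gt0// sqrtr_gt0.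
have mD : measurable (D : set (measurableTypeR R)) by [].
apply: (@lt_le_trans _ _ (\int[leb]_(t in `[c, d]) m%:E)%E).
  rewrite integral_cst//= lebesgue_measure_itv/= lte_fin cd -EFinB -EFinM lte_fin.
  by rewrite mulr_gt0// subr_gt0.
apply: (@le_trans _ _ (\int[leb]_(t in `[c, d]) (semicircle_pdf t)%:E)%E).
  apply: ge0_le_integral => //.
  - by move=> t _; rewrite lee_fin ltW.
  - by apply/measurable_EFinP/measurable_funTS; exact: measurable_semicircle_pdf.
  - move=> t /=; rewrite in_itv/= => /andP[ct td].
    have tM : t ^+ 2 <= M ^+ 2.
      rewrite -[t ^+ 2]real_normK ?num_real// ler_pXn2r ?nnegrE//;
        last by rewrite le_max normr_ge0.
      rewrite le_max; have [t0|t0] := leP 0 t.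
        by rewrite (ger0_norm t0) (ger0_norm (le_trans t0 td)) td orbT.
      by rewrite (ltr0_norm t0) ltr0_norm ?(le_lt_trans ct)// lerN2 ct.
    rewrite lee_fin ler_pM2l ?invr_gt0 ?pi_gt0// ler_sqrt ?lerB//.
    by rewrite subr_ge0 (le_trans tM)// ltW// -subr_gt0.
apply: ge0_subset_integral => //.
- exact: measurableI.
- by apply/measurable_EFinP/measurable_funTS; exact: measurable_semicircle_pdf.
- by move=> t _; rewrite lee_fin semicircle_pdf_ge0.
- move=> t /=; rewrite !in_itv/= => /andP[ct td]; split; apply/andP; split; lra.
Qed.

End semicircle_cdf.

Lemma exists_distribution d d' (T : measurableType d) (T' : measurableType d')
    (R : realType) (P : probability T R) (f : T -> T') :
  measurable_fun setT f ->
  exists Q : probability T' R, forall A, Q A = P (f @^-1` A).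
Proof.
move=> mf.
pose g : {mfun T >-> T'} := HB.pack f (isMeasurableFun.Build _ _ T T' f mf).
by exists (distribution P g).
Qed.

(** * Monotone transport of the semicircle law *)

Section monotone_transport.
Variable R : realType.
Local Notation leb := (@lebesgue_measure R).
Local Notation sc := (@semicircle R).
Local Notation D := (`](- Num.sqrt 2), (Num.sqrt 2)[%classic : set R).
Local Notation r2 := (Num.sqrt 2 : R).

Let S (t : R) : R := fine (sc `]-oo, t]%classic).

Let SE t : sc `]-oo, t]%classic = (S t)%:E.
Proof.
rewrite /S fineK// ge0_fin_numE// (le_lt_trans (probability_le1 _ _))// ?ltry//.
Qed.

Let SB a b : a <= b -> sc `]a, b]%classic = (S b - S a)%:E.
Proof.
move=> ab; rewrite EFinB -!SE.
have -> : `]a, b]%classic = `]-oo, b]%classic `\` `]-oo, a]%classic :> set R.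
  by rewrite -[RHS]setCK setCD setCitvl setUC -[LHS]setCK setCitv.
rewrite (measureD (mu := sc))//.
  by rewrite setIidr//; exact: subset_itvl.
by rewrite (le_lt_trans (probability_le1 _ _))// ltry.
Qed.

Let S_lt a b : - r2 <= a -> a < b -> b <= r2 -> S a < S b.
Proof.
by move=> ra ab br; rewrite -subr_gt0 -lte_fin -SB ?(ltW ab)// semicircle_itv_gt0.
Qed.

Let S_le a b : a <= b -> S a <= S b.
Proof. by move=> ab; rewrite -subr_ge0 -lee_fin -SB. Qed.

Let S_lip a b : a <= b -> S b - S a <= b - a.
Proof.
move=> ab; rewrite -lee_fin -SB// (le_trans (semicircle_le_lebesgue _))//.
rewrite lebesgue_measure_itv/= lte_fin; case: ifPn => // _.
by rewrite lee_fin subr_ge0.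
Qed.

Let S_continuous : continuous S.
Proof.
move=> x; apply/cvgrPdist_le => e e0; near=> y.
apply: (@le_trans _ _ `|x - y|); last first.
  by near: y; apply: (@cvgr_dist_le _ _ _ _ _ id x) => //; exact: cvg_id.
have [xy|/ltW yx] := leP x y.
  rewrite distrC ger0_norm ?subr_ge0 ?S_le//.
  by rewrite distrC ger0_norm ?subr_ge0// S_lip.
rewrite ger0_norm ?subr_ge0 ?S_le//.
by rewrite ger0_norm ?subr_ge0// S_lip.
Unshelve. all: by end_near. Qed.

Let SNr2 : S (- r2) = 0.
Proof.
apply/EFin_inj; rewrite -SE /semicircle (_ : _ `&` _ = set0) ?integral_set0//.
by rewrite -subset0 => t /=; rewrite !in_itv/= => -[]; lra.
Qed.

Let Sr2 : S r2 = 1.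
Proof.
have : (sc (~` `]-oo, r2]) = 0)%E.
  rewrite setCitvl /semicircle (_ : _ `&` _ = set0) ?integral_set0//.
  by rewrite -subset0 => t /=; rewrite !in_itv/= => -[]; lra.
rewrite probability_setC// [X in (_ - X)%E]SE -EFinB => h.
by have := EFin_inj h; lra.
Qed.

(** [S] maps the semicircle law to the uniform law: by continuity the level [u] is attained at some
    [a], and strict monotonicity on the support identifies the sublevel set with the ray ending at
    [a]. *)
Let sc_S_le u : 0 <= u <= 1 -> sc (D `&` [set t | S t <= u]) = u%:E.
Proof.
move=> /andP[u0 u1].
have r0 : 0 < r2 by rewrite sqrtr_gt0.
have [|||a] := @IVT R S (- r2) r2 u.
- lra.
- exact: continuous_subspaceT.
- by rewrite SNr2 Sr2 ge_min le_max u0 u1 orbT.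
rewrite in_itv/= => /andP[ra ar] Sa.
rewrite -Sa -SE.
have mD : measurable (D : set (measurableTypeR R)) by [].
rewrite /semicircle; congr (integral _ _ _).
rewrite predeqE => t /=; rewrite !in_itv/=; split.
  move=> [[t12 St] _]; split=> //; rewrite leNgt; apply/negP => at_.
  have := S_lt ra at_ _; case/andP : t12 => t1 t2 => /(_ (ltW t2)).
  by rewrite ltNge St.
move=> [ta t12]; split=> //; split=> //; exact: S_le.
Qed.

Variable rho : probability (measurableTypeR R) R.

Let X : measurableTypeR R -> R := idfun.

#[local] HB.instance Definition _ :=
  @isMeasurableFun.Build _ _ _ _ X (@measurable_id _ _ setT).

Let F (x : R) : R := fine (cdf (X : {RV rho >-> R}) x).

Let FE x : cdf (X : {RV rho >-> R}) x = (F x)%:E.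
Proof. by rewrite /F fineK// fin_num_measure. Qed.

Let F_le x y : x <= y -> F x <= F y.
Proof. by move=> xy; rewrite -lee_fin -!FE cdf_nondecreasing. Qed.

Let E (t : R) : set R := [set x | S t <= F x].

(** The quantile function of [rho] at level [S t]. *)
Let g0 (t : R) : R := inf (E t).

Let SD t : D t -> 0 < S t < 1.
Proof.
rewrite /= in_itv/= => /andP[t1 t2].
have := S_lt (lexx _) t1 (ltW t2); have := S_lt (ltW t1) t2 (lexx _).
by rewrite SNr2 Sr2 => -> ->.
Qed.

Let E_inf t : D t -> has_inf (E t).
Proof.
move=> /SD /andP[S0 S1]; split.
  have c1 : F x @[x --> +oo%R] --> (1 : R) by exact/fine_cvg/cvg_cdfy1.
  have [x h] := filter_ex (cvgr_ge _ c1 _ S1).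
  by exists x.
have c0 : F x @[x --> -oo%R] --> (0 : R) by exact/fine_cvg/cvg_cdfNy0.
have [x h] := filter_ex (cvgr_lt _ c0 _ S0).
exists x => y; rewrite /E /= leNgt => yS; rewrite leNgt; apply/negP => yx.
by move/negP : yS; apply; rewrite (le_lt_trans (F_le (ltW yx))).
Qed.

Let E_up t x y : x <= y -> E t x -> E t y.
Proof. by move=> xy /le_trans; apply; exact: F_le. Qed.

Let E_closed t : D t -> E t (g0 t).
Proof.
move=> Dt; rewrite /E /=.
have rc : F x @[x --> (g0 t)^'+] --> F (g0 t).
  apply: fine_cvg; rewrite -/(F _) -FE; exact: cdf_right_continuous.
apply: (cvgr_to_ge rc).
near=> x.
have gx : g0 t < x by near: x; exact: nbhs_right_gt.
have [y Ey yx] := inf_lt (E_inf Dt).1 gx.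
exact: (E_up (ltW yx) Ey).
Unshelve. all: by end_near. Qed.

(** The Galois connection between quantiles and distribution function; right continuity of [F] puts
    the infimum inside [E t], which gives the direct implication. *)
Let g0_le t x : D t -> (g0 t <= x) = (S t <= F x).
Proof.
move=> Dt; apply/idP/idP => h; first exact: (E_up h (E_closed Dt)).
by apply: ge_inf => //; case: (E_inf Dt).
Qed.

(** By the Galois connection the preimage of a left ray under the quantile map is a sublevel set of
    [S], whose mass is the value of [F]; two laws with the same distribution function agree. *)
Lemma monotone_transport : exists g : R -> R, [/\ measurable_fun setT g,
  {in D &, {homo g : s t / s <= t}} &
  forall A, measurable A -> rho A = sc (g @^-1` A)].
Proof.
have mD : measurable (D : set (measurableTypeR R)) by [].
have g0_homo : {in D &, {homo g0 : s t / s <= t}}.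
  move=> s t /set_mem Ds /set_mem Dt st; rewrite g0_le//.
  apply: le_trans (S_le st) _; exact: E_closed.
have mg0 : measurable_fun D g0.
  apply: (measurability (@RGenCInfty.G R)) => [|/= _ [_] [r] -> <-].
    exact: RGenCInfty.measurableE.
  (* By monotonicity the preimage of a ray inside [D] is an interval. *)
  apply: is_interval_measurable => s t/= [Ds gs] [Dt gt] u /andP[su ut].
  have Du : D u.
    move: Ds Dt; rewrite /= !in_itv/= => /andP[? ?] /andP[? ?].
    by apply/andP; split; lra.
  have gsu : g0 s <= g0 u by apply: g0_homo => //; exact: mem_set.
  split; first exact: Du.
  have gs' : g0 s \in `[r, +oo[ := gs.
  change (g0 u \in `[r, +oo[); move: (g0 s) (g0 u) gs' gsu => a b.
  by rewrite !in_itv/= !andbT; exact: le_trans.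
(* Outside [D] the level [S t] is 0 or 1, where [E t] can be unbounded below or empty; the value 0
   is given there, on a null set. *)
pose g := g0 \_ D.
have mg : measurable_fun setT g by apply/(measurable_restrictT _ _).1.
exists g; split; first exact: mg.
  by move=> s t Ds Dt; rewrite /g !patchE Ds Dt; exact: g0_homo.
have [Q QE] := @exists_distribution _ _ (measurableTypeR R) (measurableTypeR R) R
  sc g mg.
move=> A mA; rewrite -QE; apply: eq_measure_cdf => // x; rewrite QE.
transitivity (F x)%:E; first by rewrite -FE.
have F01 : 0 <= F x <= 1 by rewrite -!lee_fin -FE cdf_ge0 cdf_le1.
rewrite -(sc_S_le F01).
rewrite /semicircle; congr (integral _ _ _).
rewrite predeqE => t /=; rewrite /g !in_itv/= patchE; split.
  move=> [[t12 h] _]; split=> //; rewrite mem_set ?g0_le//.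
move=> [h t12]; split=> //; split=> //.
by rewrite -g0_le//; move: h; rewrite mem_set.
Qed.

End monotone_transport.

(** * Logarithmic energy on the line *)

Section log_kernel.
Variable R : realType.
Local Notation leb := (@lebesgue_measure R).
Local Notation sc := (@semicircle R).
Local Notation D := (`](- Num.sqrt 2), (Num.sqrt 2)[%classic : set R).
Implicit Types x y s t : R.

Definition log_kernel x y : \bar R :=
  if x == y then +oo%E else (- ln `|x - y| + 2^-1 * (x ^+ 2 + y ^+ 2))%:E.

Lemma ln_le x : 0 < x -> ln x <= x - 1.
Proof. by move=> x0; have := @le_ln1Dx R (x - 1); rewrite subrKC; apply; lra. Qed.

(** With z = |x - y| the confinement is at least z^2 / 4, and z^2 / 4 - ln z is smallest at z^2 = 2;
    hence the tangent bound for the logarithm is applied to z^2 / 2. *)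
Lemma log_kernel_ge0 x y : (0 <= log_kernel x y)%E.
Proof.
rewrite /log_kernel; case: eqVneq => [_|xy]; first exact: leey.
rewrite lee_fin.
have z0 : 0 < `|x - y| by rewrite normr_gt0 subr_eq0.
have zE : `|x - y| ^+ 2 = (x - y) ^+ 2 by rewrite real_normK ?num_real.
have : ln (`|x - y| ^+ 2 / 2) <= `|x - y| ^+ 2 / 2 - 1.
  by apply: ln_le; rewrite divr_gt0// exprn_gt0.
rewrite ln_div ?posrE ?exprn_gt0// lnXn// zE.
have : ln 2 <= 2 - 1 :> R by exact: ln_le.
move: (ln `|x - y|) (ln 2) => a b.
have := sqr_ge0 (x + y); rewrite (mulr2n a) => h0 h1 h2; nra.
Qed.

(** Finite logarithmic energy thus forces a finite second moment. With z = |x - y| and ln z <= z -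
    1, what remains is at least z^2 / 8 - z + 2 = (z - 4)^2 / 8. *)
Lemma sqr_le_log_kernel x y :
  ((4^-1 * (x ^+ 2 + y ^+ 2))%:E <= log_kernel x y + 1)%E.
Proof.
rewrite /log_kernel; case: eqVneq => [_|xy]; first exact: leey.
rewrite -EFinD lee_fin.
have z0 : 0 < `|x - y| by rewrite normr_gt0 subr_eq0.
have zE : `|x - y| ^+ 2 = (x - y) ^+ 2 by rewrite real_normK ?num_real.
have := ln_le z0; move: (ln `|x - y|) => a.
have := sqr_ge0 (`|x - y| - 4); have := sqr_ge0 (x + y).
move: (`|x - y|) z0 zE => z z0 zE h0 h1 h2; nra.
Qed.

Lemma measurable_log_kernel :
  measurable_fun setT (fun z : plane R => log_kernel z.1 z.2).
Proof.
apply: measurable_fun_ifT.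
- by apply: measurable_fun_eqr.
- exact: measurable_cst.
- apply/measurable_EFinP; apply: measurable_funD.
    apply: measurable_funN; apply: (measurableT_comp (@measurable_ln R)).
    by apply: (measurableT_comp (@normr_measurable R setT)); exact: measurable_funB.
  apply: measurable_funM => //.
  by apply: measurable_funD; apply: measurable_funX.
Qed.

(* [-ln z] is at most the number of [k] with [z <= expR (-k)]. *)
Lemma Nln_le_series x : 0 < x ->
  ((- ln x)%:E <= \sum_(k <oo) (\1_`]-oo, expR (- k%:R)] x)%:E)%E.
Proof.
move=> x0; have [lnx|lnx] := leP (- ln x) 0.
  by rewrite (@le_trans _ _ 0%E)// nneseries_ge0// => k _; rewrite lee_fin.
set n := (Num.truncn (- ln x)).+1.
apply: (@le_trans _ _ (\sum_(0 <= k < n) (\1_`]-oo, expR (- k%:R)] x)%:E)%E);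
  last by apply: nneseries_lim_ge => k _; rewrite lee_fin.
rewrite sumEFin lee_fin (@eq_big_nat _ _ _ _ _ _ (fun=> 1)).
  by rewrite sumr_const_nat subn0 ltW// /n truncnS_gt.
move=> k /andP[_ kn]; rewrite indicE mem_set//= in_itv/=.
rewrite -[leLHS]lnK ?posrE// ler_expR lerNr.
by rewrite -(truncn_ge_nat _ (ltW lnx)) -ltnS; exact: kn.
Qed.

Lemma semicircle_ball_le t r : 0 <= r ->
  (sc [set s : R | (`|t - s| <= r)%R] <= (2 * r)%:E)%E.
Proof.
move=> r0; have -> : [set s : R | `|t - s| <= r] = `[t - r, t + r]%classic.
  by rewrite predeqE => s /=; rewrite in_itv/= ler_distlC.
apply: (le_trans (semicircle_le_lebesgue _)) => //.
rewrite lebesgue_measure_itv/=; case: ifPn => _; last by rewrite lee_fin mulr_ge0.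
by rewrite -EFinB lee_fin; lra.
Qed.

Let series_geo : (\sum_(k <oo) (2 * expR (- k%:R) : R)%:E < +oo)%E.
Proof.
have e1 : `|expR (-1) : R| < 1.
  by rewrite gtr0_norm ?expR_gt0// -expR0 ltr_expR ltrN10.
have c := cvg_geometric_series (a := 2 : R) e1.
have -> : (fun n => \sum_(0 <= k < n) (2 * expR (- k%:R) : R)%:E)%E =
    EFin \o series (geometric (2 : R) (expR (-1))).
  apply/funext => n; rewrite /= /series /= sumEFin; congr EFin.
  by apply: eq_bigr => k _; rewrite -expRM_natl mulrN1.
have c' : (EFin \o series (geometric (2 : R) (expR (-1)))) @ \oo -->
    (2 / (1 - expR (-1)) : R)%:E by apply: cvg_EFin => //; exact: nearW.
by rewrite (cvg_lim _ c')// ltry.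
Qed.

Let S2 (t s : R) : \bar R := (\sum_(k <oo) (\1_`]-oo, expR (- k%:R)] `|t - s|)%:E)%E.

Let meas_ind k : measurable_fun setT
  (fun z : plane R => ((\1_`]-oo, expR (- k%:R)] (`|z.1 - z.2| : R) : R))%:E).
Proof.
apply/measurable_EFinP.
have mI : measurable_fun setT (\1_`]-oo, expR (- k%:R)] : measurableTypeR R -> R).
  exact: measurable_indic.
apply: (measurableT_comp mI).
by apply: (measurableT_comp (@normr_measurable R setT)); exact: measurable_funB.
Qed.

(** On the diagonal every indicator is 1 and the series is [+oo] as well; elsewhere the constant 2
    bounds the confinement on the support. *)
Let log_kernel_le_series t s : D t -> D s -> (log_kernel t s <= S2 t s + 2%:E)%E.
Proof.
move=> Dt Ds; rewrite /log_kernel; case: eqVneq => [->|ts].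
  rewrite /S2 [X in (X + _)%E](_ : _ = +oo)%E//.
  rewrite subrr normr0 (eq_eseriesr (g := fun=> 1%E)); last first.
    by move=> k _; rewrite indicE mem_set//= in_itv/= expR_ge0.
  apply/eqyP => M M0.
  apply: le_trans (nneseries_lim_ge (Num.truncn M).+1 _) => //.
  rewrite sumEFin lee_fin sumr_const_nat subn0.
  by rewrite ltW// truncnS_gt.
have z0 : 0 < `|t - s| by rewrite normr_gt0 subr_eq0.
rewrite EFinD leeD// ?Nln_le_series// lee_fin.
by have := semicircle_suppP Dt; have := semicircle_suppP Ds => *; lra.
Qed.

Lemma semicircle_supp1 : sc D = 1%E.
Proof.
have : sc setT = 1%E by exact: probability_setT.
by rewrite /semicircle setTI setIid.
Qed.

Lemma ae_semicircle2_supp :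
  {ae (sc \x sc)%E, forall z : plane R, D z.1 /\ D z.2}.
Proof.
have mD : measurable (D : set (measurableTypeR R)) by [].
have mDD : measurable ((D : set (measurableTypeR R)) `*` (D : set (measurableTypeR R))).
  exact: measurableX.
have e : (sc D * sc D = 1)%E by rewrite semicircle_supp1 mule1.
have DD1 := etrans (product_measure1E sc sc mD mD) e.
exists (~` (D `*` D)); split; first exact: measurableC.
  by rewrite probability_setC// [X in (_ - X)%E]DD1 subee.
by move=> z /= h [h1 h2]; apply: h; split.
Qed.

(** Integrated term by term, the series becomes a sum of masses of balls of radius [expR (- k%:R)],
    each at most twice its radius, and is dominated by a geometric series. *)
Lemma integral_log_kernel_semicircle_lty :
  (\int[sc \x sc]_z log_kernel z.1 z.2 < +oo)%E.
Proof.
have S20 z : (0 <= S2 z.1 z.2)%E.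
  by apply: nneseries_ge0 => k _ _; rewrite lee_fin.
have mS2 : measurable_fun setT (fun z : plane R => S2 z.1 z.2).
  by apply: (ge0_emeasurable_sum (P := predT)) => // k z _ _; rewrite lee_fin.
apply: (@le_lt_trans _ _ (\int[sc \x sc]_z (S2 z.1 z.2 + 2%:E))%E).
  apply: ae_ge0_le_integral => //.
  - by move=> z _; exact: log_kernel_ge0.
  - exact: measurable_log_kernel.
  - by move=> z _; rewrite adde_ge0// lee_fin.
  - by apply: emeasurable_funD.
  - by apply: filterS ae_semicircle2_supp => z [D1 D2] _; exact: log_kernel_le_series.
rewrite ge0_integralD//.
rewrite lte_add_pinfty//; last first.
  rewrite integral_cst// lte_mul_pinfty// ?lee_fin//.
  by rewrite (le_lt_trans (probability_le1 _ _))// ltry.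
rewrite integral_nneseries//.
apply: le_lt_trans series_geo.
apply: lee_nneseries => [k _ _|k _].
  by apply: integral_ge0 => z _; rewrite lee_fin.
rewrite fubini_tonelli1//.
apply: (@le_trans _ _ (\int[sc]_t (2 * expR (- k%:R) : R)%:E)%E); last first.
  rewrite integral_cst// -[leRHS]mule1 lee_wpmul2l ?lee_fin ?mulr_ge0 ?expR_ge0//.
  exact: probability_le1.
apply: ge0_le_integral => //.
- by move=> t _; apply: integral_ge0 => s _; rewrite lee_fin.
- exact: measurable_fun_fubini_tonelli_F.
- move=> t _; apply: le_trans (@semicircle_ball_le t _ (expR_ge0 _)).
  set B := [set s : R | _].
  have mB : measurable (B : set (measurableTypeR R)).
    rewrite (_ : B = `[t - expR (- k%:R), t + expR (- k%:R)]%classic)//.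
    by rewrite predeqE /B => s /=; rewrite in_itv/= ler_distlC.
  rewrite [leLHS](_ : _ = \int[sc]_s (\1_B s)%:E)%E; last first.
    apply: eq_integral => s _ /=; rewrite !indicE.
    have -> // : (`|t - s| \in `]-oo, expR (- k%:R)]%classic) = (s \in B).
    by apply/idP/idP => /set_mem h; apply/mem_set; move: h; rewrite /B /= in_itv.
  by rewrite integral_indic// setIT.
Qed.

End log_kernel.

(** * Integrals against image measures *)

Section image_measure.
Local Open Scope ereal_scope.
Context d d' (T : measurableType d) (T' : measurableType d') (R : realType).
Variables (P : probability T R) (Q : probability T' R) (f : T -> T').
Hypothesis mf : measurable_fun setT f.
Hypothesis QE : forall A, measurable A -> Q A = P (f @^-1` A).

Lemma ge0_integral_image (h : T' -> \bar R) :
  measurable_fun setT h -> (forall y, 0 <= h y) ->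
  \int[Q]_y h y = \int[P]_x h (f x).
Proof.
move=> mh h0; have := ge0_integral_pushforward mf P measurableT mh.
rewrite preimage_setT => <- //.
by apply: eq_measure_integral => A mA _; exact: QE.
Qed.

Lemma ge0_integral_image2 (h : T' * T' -> \bar R) :
  measurable_fun setT h -> (forall y, 0 <= h y) ->
  \int[Q \x Q]_z h z = \int[P \x P]_z h (f z.1, f z.2).
Proof.
move=> mh h0.
have mff : measurable_fun setT (fun z : T * T => (f z.1, f z.2)).
  by apply/measurable_fun_pair; apply: measurableT_comp.
rewrite fubini_tonelli1// [RHS]fubini_tonelli1//; last first.
  exact: (measurableT_comp mh mff).
rewrite ge0_integral_image//; last 2 first.
- exact: measurable_fun_fubini_tonelli_F.
- by move=> y; apply: integral_ge0.
apply: eq_integral => x _; rewrite /fubini_F/=.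
rewrite ge0_integral_image//.
exact: (measurable_fun_pair2 (f x) mh).
Qed.

End image_measure.

(** * Minimality of the semicircle law on the line *)

Section one_dimensional.
Variable R : realType.
Local Notation sc := (@semicircle R).
Local Notation D := (`](- Num.sqrt 2), (Num.sqrt 2)[%classic : set R).

(* Tangent line inequality for the convex function [-ln]. *)
Lemma log_kernel_tangent (x y s t : R) : s != t -> 0 <= (x - y) / (s - t) ->
  (log_kernel s t + (1 + 2^-1 * (x ^+ 2 + y ^+ 2))%:E <=
   log_kernel x y + ((x - y) / (s - t) + 2^-1 * (s ^+ 2 + t ^+ 2))%:E)%E.
Proof.
move=> st r0; rewrite /log_kernel (negbTE st).
case: eqVneq => [_|xy]; first by rewrite addye// leey.
rewrite -!EFinD lee_fin.
have st0 : 0 < `|s - t| by rewrite normr_gt0 subr_eq0.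
have xy0 : 0 < `|x - y| by rewrite normr_gt0 subr_eq0.
have := ln_le (divr_gt0 xy0 st0); rewrite ln_div ?posrE//.
rewrite -normf_div (ger0_norm r0).
move: (ln _) (ln _) ((x - y) / (s - t)) => a b c; lra.
Qed.

Lemma integral_semicircle2_fst (h : R -> \bar R) :
  measurable_fun setT h -> (forall t, 0 <= h t)%E ->
  (\int[sc \x sc]_z h z.1 = \int[sc]_t h t)%E.
Proof.
move=> mh h0; rewrite fubini_tonelli1//; last exact: (measurableT_comp mh).
apply: eq_integral => t _; rewrite /fubini_F/= integral_cst//.
by rewrite [X in (_ * X)%E]probability_setT mule1.
Qed.

Lemma integral_semicircle2_snd (h : R -> \bar R) :
  measurable_fun setT h -> (forall t, 0 <= h t)%E ->
  (\int[sc \x sc]_z h z.2 = \int[sc]_t h t)%E.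
Proof.
move=> mh h0; rewrite fubini_tonelli2//; last exact: (measurableT_comp mh).
apply: eq_integral => t _; rewrite /fubini_G/= integral_cst//.
by rewrite [X in (_ * X)%E]probability_setT mule1.
Qed.

Lemma integral_semicircle2_mean (h : R -> R) (c : R) :
  measurable_fun setT h -> (forall t, 0 <= h t) ->
  (\int[sc]_t (h t)%:E = c%:E)%E ->
  (\int[sc \x sc]_z (2^-1 * (h z.1 + h z.2))%:E = c%:E)%E.
Proof.
move=> mh h0 hc.
have mh2 : measurable_fun setT (fun t => (2^-1 * h t)%:E).
  by apply/measurable_EFinP; exact: measurable_funM.
have h20 t : (0 <= (2^-1 * h t)%:E)%E by rewrite lee_fin mulr_ge0 ?invr_ge0.
have e : (\int[sc]_t (2^-1 * h t)%:E = (2^-1 * c)%:E)%E.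
  rewrite EFinM -hc -ge0_integralZl//.
  - exact/measurable_EFinP.
  - by move=> t _; rewrite lee_fin.
transitivity (\int[sc \x sc]_z ((2^-1 * h z.1)%:E + (2^-1 * h z.2)%:E))%E.
  by apply: eq_integral => z _; rewrite -EFinD mulrDr.
rewrite ge0_integralD//; last 2 first.
- exact: (measurableT_comp mh2 measurable_fst).
- exact: (measurableT_comp mh2 measurable_snd).
rewrite (integral_semicircle2_fst mh2)// (integral_semicircle2_snd mh2)// e.
by rewrite -EFinD; congr EFin; field.
Qed.

Variable rho : probability (measurableTypeR R) R.
Local Notation L := (\int[sc \x sc]_z log_kernel z.1 z.2)%E.
Local Notation La := (\int[rho \x rho]_z log_kernel z.1 z.2)%E.

Section transported.
Variable g : R -> R.
Hypothesis mg : measurable_fun setT g.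
Hypothesis ndg : {in D &, {homo g : s t / s <= t}}.
Hypothesis gE : forall A, measurable A -> rho A = sc (g @^-1` A).
Hypothesis La_lty : (La < +oo)%E.

Let LaE : La = (\int[sc \x sc]_z log_kernel (g z.1) (g z.2))%E.
Proof.
apply: (@ge0_integral_image2 _ _ (measurableTypeR R) (measurableTypeR R) R sc rho g
  mg gE (fun z => log_kernel z.1 z.2)).
  exact: measurable_log_kernel.
by move=> z; exact: log_kernel_ge0.
Qed.

Let mgk : measurable_fun setT (fun z : plane R => log_kernel (g z.1) (g z.2)).
Proof.
have mgg : measurable_fun setT (fun z : plane R => (g z.1, g z.2) : plane R).
  apply/measurable_fun_pair; first exact: (measurableT_comp mg measurable_fst).
  exact: (measurableT_comp mg measurable_snd).
exact: (measurableT_comp (@measurable_log_kernel R) mgg).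
Qed.

Let mg2 : measurable_fun setT (fun t => (g t ^+ 2)%:E).
Proof. by apply/measurable_EFinP; exact: measurable_funX. Qed.

Let ig2 : sc.-integrable setT (fun t => (g t ^+ 2)%:E).
Proof.
apply/integrableP; split; first exact: mg2.
under eq_integral do rewrite gee0_abs ?lee_fin ?sqr_ge0//.
have : (\int[sc \x sc]_z (4^-1 * g z.1 ^+ 2)%:E <= La + 1)%E.
  apply: (@le_trans _ _ (\int[sc \x sc]_z (log_kernel (g z.1) (g z.2) + 1))%E).
    apply: ge0_le_integral => //.
    - by move=> z _; rewrite lee_fin mulr_ge0 ?invr_ge0 ?sqr_ge0.
    - apply/measurable_EFinP; apply: measurable_funM => //; apply: measurable_funX.
      exact: (measurableT_comp mg measurable_fst).
    - by apply: emeasurable_funD => //.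
    - move=> z _; apply: le_trans (sqr_le_log_kernel _ _).
      by rewrite lee_fin ler_wpM2l ?invr_ge0// lerDl sqr_ge0.
  rewrite ge0_integralD//; last by move=> z _; exact: log_kernel_ge0.
  rewrite -LaE integral_cst//.
  by rewrite leeD2l// mul1e probability_le1.
rewrite (integral_semicircle2_fst (h := fun t => (4^-1 * g t ^+ 2)%:E)); last 2 first.
- by apply/measurable_EFinP; apply: measurable_funM => //; exact: measurable_funX.
- by move=> t; rewrite lee_fin mulr_ge0 ?invr_ge0 ?sqr_ge0.
have -> : (\int[sc]_t (4^-1 * g t ^+ 2)%:E = 4^-1%:E * \int[sc]_t (g t ^+ 2)%:E)%E.
  by rewrite -ge0_integralZl// => t _; rewrite lee_fin sqr_ge0.
move=> h; rewrite ltNge leye_eq; apply/negP => /eqP e.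
move: h; rewrite e gt0_muley ?lte_fin ?invr_gt0// leye_eq => /eqP h.
by have := lte_add_pinfty La_lty (ltry 1); rewrite h ltxx.
Qed.

Let ig : sc.-integrable setT (EFin \o g).
Proof.
have i1 : sc.-integrable setT (fun t => (g t ^+ 2)%:E + 1%:E)%E.
  by apply: integrableD => //; exact: finite_measure_integrable_cst.
apply: le_integrable i1 => //; first exact/measurable_EFinP.
move=> t _; rewrite /= lee_fin [leRHS]ger0_norm ?addr_ge0 ?sqr_ge0//.
rewrite -[g t ^+ 2]real_normK ?num_real//.
by have := sqr_ge0 (`|g t| - 1); have := normr_ge0 (g t); nra.
Qed.

Let sq_id_int : sc.-integrable setT (fun t : R => (t ^+ 2)%:E).
Proof.
apply/integrableP; split; first by apply/measurable_EFinP; exact: measurable_funX.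
under eq_integral do rewrite gee0_abs ?lee_fin ?sqr_ge0//.
by rewrite semicircle_second_moment ltry.
Qed.

Let a := fine (\int[sc]_t (g t ^+ 2)%:E)%E.
Let b := fine (\int[sc]_t (g t * t)%:E)%E.

Let aE : (\int[sc]_t (g t ^+ 2)%:E)%E = a%:E.
Proof. by rewrite /a fineK// integrable_fin_num. Qed.

Let igt : sc.-integrable setT (fun t : R => (g t * t)%:E).
Proof.
apply: (le_integrable measurableT _ _ (integrableD measurableT ig2 sq_id_int)).
  by apply/measurable_EFinP; exact: measurable_funM.
move=> t _; rewrite /= lee_fin normrM [leRHS]ger0_norm ?addr_ge0 ?sqr_ge0//.
rewrite -[g t ^+ 2]real_normK ?num_real// -[t ^+ 2]real_normK ?num_real//.
have := sqr_ge0 (`|g t| - `|t|); have := normr_ge0 (g t); have := normr_ge0 t.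
by move=> *; nra.
Qed.

Let bE : (\int[sc]_t (g t * t)%:E)%E = b%:E.
Proof. by rewrite /b fineK// integrable_fin_num. Qed.

Let gap : (\int[sc]_t ((g t - t) ^+ 2)%:E)%E = (a - 2 * b + 2^-1)%:E.
Proof.
transitivity (\int[sc]_t ((g t ^+ 2)%:E + (t ^+ 2)%:E - 2%:E * (g t * t)%:E))%E.
  by apply: eq_integral => t _; rewrite -EFinM -EFinN -!EFinD; congr EFin; ring.
rewrite integralB//; last 2 first.
- exact: integrableD.
- exact: integrableZl.
rewrite integralD// integralZl// aE bE semicircle_second_moment.
by rewrite -EFinM -EFinN -!EFinD; congr EFin; ring.
Qed.

Let quot (z : plane R) : R :=
  \1_D z.1 * \1_D z.2 * ((g z.1 - g z.2) / (z.1 - z.2)).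

Let quot_ge0 z : 0 <= quot z.
Proof.
rewrite /quot !indicE.
have [z1|] := boolP (z.1 \in D); last by rewrite !mul0r.
have [z2|] := boolP (z.2 \in D); last by rewrite mulr0 !mul0r.
rewrite !mul1r; have [le12|/ltW le21] := leP z.1 z.2.
  by rewrite mulr_le0 ?invr_le0 ?subr_le0// ndg.
by rewrite mulr_ge0 ?invr_ge0 ?subr_ge0// ndg.
Qed.

Let mquot : measurable_fun setT quot.
Proof.
have mD : measurable (D : set (measurableTypeR R)) by [].
have mI : measurable_fun setT (\1_D : measurableTypeR R -> R).
  exact: measurable_indic.
apply: measurable_funM.
  apply: measurable_funM; first exact: (measurableT_comp mI measurable_fst).
  exact: (measurableT_comp mI measurable_snd).
apply: measurable_funM.
  apply: measurable_funB; first exact: (measurableT_comp mg measurable_fst).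
  exact: (measurableT_comp mg measurable_snd).
by apply: measurable_funV; exact: measurable_funB.
Qed.

Let tangent_quot z : D z.1 -> D z.2 ->
  (log_kernel z.1 z.2 + (1 + 2^-1 * (g z.1 ^+ 2 + g z.2 ^+ 2))%:E <=
   log_kernel (g z.1) (g z.2) + (quot z + 2^-1 * (z.1 ^+ 2 + z.2 ^+ 2))%:E)%E.
Proof.
move=> D1 D2; have [z12|z12] := eqVneq z.1 z.2.
  (* On the diagonal the transported kernel is [+oo] too and absorbs the rest. *)
  by rewrite z12 {2}/log_kernel eqxx addye// leey.
have := quot_ge0 z; rewrite /quot !indicE !mem_set// !mul1r => q0.
exact: log_kernel_tangent.
Qed.

(** Integrating the tangent inequality gives L + 1 + a <= La + 2 b + 1/2. The 1 of the tangent line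
    less the second moment 1/2 leaves 1/2, which is again the second moment and completes a - 2 b to
    the squared distance from [g] to the identity. *)
Lemma log_energy_gap : (L + \int[sc]_t ((g t - t) ^+ 2)%:E <= La)%E.
Proof.
have L0 : (0 <= L)%E by apply: integral_ge0 => z _; exact: log_kernel_ge0.
have La0 : (0 <= La)%E by apply: integral_ge0 => z _; exact: log_kernel_ge0.
have Lfin : L \is a fin_num.
  by rewrite ge0_fin_numE// integral_log_kernel_semicircle_lty.
have Lafin : La \is a fin_num by rewrite ge0_fin_numE.
have mgg : measurable_fun setT (fun z : plane R => 2^-1 * (g z.1 ^+ 2 + g z.2 ^+ 2)).
  apply: measurable_funM => //; apply: measurable_funD; apply: measurable_funX.
    exact: (measurableT_comp mg measurable_fst).
  exact: (measurableT_comp mg measurable_snd).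
have mtt : measurable_fun setT (fun z : plane R => 2^-1 * (z.1 ^+ 2 + z.2 ^+ 2)).
  by apply: measurable_funM => //; apply: measurable_funD; apply: measurable_funX.
have gg0 (z : plane R) : 0 <= 2^-1 * (g z.1 ^+ 2 + g z.2 ^+ 2).
  by rewrite mulr_ge0 ?invr_ge0// addr_ge0 ?sqr_ge0.
have tt0 (z : plane R) : 0 <= 2^-1 * (z.1 ^+ 2 + z.2 ^+ 2).
  by rewrite mulr_ge0 ?invr_ge0// addr_ge0 ?sqr_ge0.
have : (\int[sc \x sc]_z (log_kernel z.1 z.2 + (1 + 2^-1 * (g z.1 ^+ 2 + g z.2 ^+ 2))%:E)
  <= \int[sc \x sc]_z (log_kernel (g z.1) (g z.2) + (quot z + 2^-1 * (z.1 ^+ 2 + z.2 ^+ 2))%:E))%E.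
  apply: ae_ge0_le_integral => //.
  - by move=> z _; rewrite adde_ge0 ?log_kernel_ge0// lee_fin addr_ge0.
  - apply: emeasurable_funD; first exact: measurable_log_kernel.
    by apply/measurable_EFinP; exact: measurable_funD.
  - by move=> z _; rewrite adde_ge0 ?log_kernel_ge0// lee_fin addr_ge0.
  - by apply: emeasurable_funD => //; apply/measurable_EFinP; exact: measurable_funD.
  - by apply: filterS (@ae_semicircle2_supp R) => z [D1 D2] _; exact: tangent_quot.
rewrite ge0_integralD//; last 4 first.
- by move=> z _; exact: log_kernel_ge0.
- exact: measurable_log_kernel.
- by move=> z _; rewrite lee_fin addr_ge0.
- by apply/measurable_EFinP; exact: measurable_funD.
rewrite [X in (_ <= X)%E]ge0_integralD//; last 3 first.
- by move=> z _; exact: log_kernel_ge0.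
- by move=> z _; rewrite lee_fin addr_ge0.
- by apply/measurable_EFinP; exact: measurable_funD.
rewrite -LaE.
have -> : (\int[sc \x sc]_z (1 + 2^-1 * (g z.1 ^+ 2 + g z.2 ^+ 2))%:E = (1 + a)%:E)%E.
  under eq_integral do rewrite EFinD.
  rewrite ge0_integralD//; [|by move=> z _; rewrite lee_fin|exact/measurable_EFinP].
  rewrite (@integral_semicircle2_mean (fun t => g t ^+ 2) a) ?sqr_ge0//; last 2 first.
  - exact: measurable_funX.
  - by move=> t; exact: sqr_ge0.
  by rewrite integral_cst// [X in (_ * X + _)%E]probability_setT mule1 EFinD.
have : (\int[sc \x sc]_z (quot z + 2^-1 * (z.1 ^+ 2 + z.2 ^+ 2))%:E <= (2 * b + 2^-1)%:E)%E.
  under eq_integral do rewrite EFinD.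
  rewrite ge0_integralD//; last 4 first.
  - by move=> z _; rewrite lee_fin.
  - exact/measurable_EFinP.
  - by move=> z _; rewrite lee_fin.
  - exact/measurable_EFinP.
  rewrite (@integral_semicircle2_mean (fun t => t ^+ 2) 2^-1); last 3 first.
  - exact: measurable_funX.
  - by move=> t; exact: sqr_ge0.
  - exact: semicircle_second_moment.
  rewrite EFinD leeD2r//.
  by have := le_integral_difference_quotient ig ndg; rewrite bE.
move=> h1 h2.
have := le_trans h2 (leeD2l La h1).
rewrite gap -(fineK Lfin) -(fineK Lafin) -!EFinD !lee_fin; lra.
Qed.

End transported.

Lemma log_energy_ge : (L <= La)%E.
Proof.
have [La_lty|] := ltP La +oo%E; last by rewrite leye_eq => /eqP ->; exact: leey.
have [g [mg ndg gE]] := monotone_transport rho.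
apply: le_trans (log_energy_gap mg ndg gE La_lty).
by rewrite leeDl// integral_ge0// => t _; rewrite lee_fin sqr_ge0.
Qed.

(** Since [L] is finite, equality forces the squared distance in the gap to vanish, so the transport
    map is the identity almost everywhere. *)
Lemma log_energy_eq : La = L -> forall A, measurable A -> rho A = sc A.
Proof.
move=> LaL; have Llty := @integral_log_kernel_semicircle_lty R.
have La_lty : (La < +oo)%E by rewrite LaL.
have [g [mg ndg gE]] := monotone_transport rho.
have := log_energy_gap mg ndg gE La_lty; rewrite LaL => h A mA.
have Lfin : L \is a fin_num.
  by rewrite ge0_fin_numE// integral_ge0// => z _; exact: log_kernel_ge0.
have msq : measurable_fun setT (fun t : R => ((g t - t) ^+ 2)%:E).
  by apply/measurable_EFinP; apply: measurable_funX; exact: measurable_funB.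
have I0 : (\int[sc]_t `|((g t - t) ^+ 2)%:E| = 0)%E.
  under eq_integral do rewrite gee0_abs ?lee_fin ?sqr_ge0//.
  apply/eqP; rewrite eq_le integral_ge0 ?andbT; last first.
    by move=> t _; rewrite lee_fin sqr_ge0.
  by move: h; rewrite -{2}(adde0 L) leeD2lE.
have ae0 := (ae_eq_integral_abs sc measurableT msq).1 I0.
rewrite gE// -[g @^-1` A]setIT -[in RHS](setIT A).
have mgA : measurable (g @^-1` A : set (measurableTypeR R)).
  by rewrite -[X in measurable X]setTI; exact: mg.
rewrite -(integral_indic sc measurableT mgA) -(integral_indic sc measurableT mA).
apply: ae_eq_integral => //.
- by apply/measurable_EFinP; exact: measurable_indic.
- by apply/measurable_EFinP; exact: measurable_indic.
apply: filterS ae0 => t /(_ Logic.I) e _.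
have /eqP : (g t - t) ^+ 2 = 0 by exact: EFin_inj e.
rewrite sqrf_eq0 subr_eq0 => /eqP gt; rewrite /= !indicE.
have -> // : (t \in g @^-1` A) = (t \in A).
by apply/idP/idP => /set_mem tA; apply/mem_set; move: tA; rewrite /preimage /= gt.
Qed.

End one_dimensional.

(** * Averaging over directions *)

Section trigonometric_integrals.
Variable R : realType.
Local Notation leb := (@lebesgue_measure R).
Implicit Types (a b c e u : R).

Lemma integral_itv_shift (F : R -> R) a b c : a <= b -> continuous F ->
  (\int[leb]_(t in `[a, b]) (F (t - c))%:E =
   \int[leb]_(t in `[(a - c)%R, (b - c)%R]) (F t)%:E)%E.
Proof.
move=> ab cF.
have dS u : is_derive u 1 (fun t : R => t - c) 1 by apply: is_derive_eq; rewrite subr0.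
have S'E : (fun t : R => t - c)^`()%classic = cst 1.
  by apply/funext => u; rewrite derive1E derive_val.
have cS : continuous (fun t : R => t - c) by continuity.
rewrite (@integration_by_substitution_increasing R (fun t => t - c) F a b)//.
- apply: eq_integral => t _; congr EFin.
  by rewrite S'E !fctE mulr1.
- by move=> x y _ _; rewrite ltrD2r.
- by rewrite S'E => x _; exact: cvg_cst.
- by rewrite S'E; apply/cvg_ex; exists 1; exact: cvg_cst.
- by rewrite S'E; apply/cvg_ex; exists 1; exact: cvg_cst.
- split => [x _||].
  + exact: ex_derive.
  + exact/cvg_at_right_filter/cS.
  + exact/cvg_at_left_filter/cS.
- exact: continuous_subspaceT.
Qed.

Lemma integral_itv_split (F : R -> R) a b c : a <= b -> b <= c ->
  continuous F -> (forall u, 0 <= F u) ->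
  (\int[leb]_(t in `[a, c]) (F t)%:E =
   \int[leb]_(t in `[a, b]) (F t)%:E + \int[leb]_(t in `[b, c]) (F t)%:E)%E.
Proof.
move=> ab bc cF F0.
have mF : measurable_fun setT F by exact: continuous_measurable_fun.
have -> : `[a, c]%classic = `[a, b]%classic `|` `]b, c]%classic :> set R.
  rewrite predeqE => t /=; rewrite !in_itv/=; split.
    by move=> /andP[at_ tc]; rewrite at_ tc; have [tb|bt] := leP t b; [left|right].
  move=> [/andP[at_ tb]|/andP[bt tc]]; apply/andP; split=> //.
    exact: le_trans bc.
  by rewrite (le_trans ab)// ltW.
rewrite ge0_integral_setU//.
- congr (_ + _)%E; apply: (@integral_itv_obnd_cbnd R b (BRight c) (EFin \o F)).
  exact/measurable_EFinP/measurable_funTS.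
- exact/measurable_EFinP/measurable_funTS.
- by move=> t _; rewrite lee_fin.
- apply/disj_setPS => t /= []; rewrite !in_itv/= => /andP[_ tb] /andP[bt _].
  by move: (lt_le_trans bt tb); rewrite ltxx.
Qed.

Lemma integral_periodic_shift (F : R -> R) b : 0 <= b -> b <= pi ->
  continuous F -> (forall u, 0 <= F u) -> (forall u, F (u + pi) = F u) ->
  (\int[leb]_(t in `[0%R, pi]) (F (t - b))%:E =
   \int[leb]_(t in `[0%R, pi]) (F t)%:E)%E.
Proof.
move=> b0 bpi cF F0 Fp; have pi0 : 0 <= pi :> R by exact: pi_ge0.
rewrite (integral_itv_shift b pi0 cF) sub0r.
rewrite (@integral_itv_split F _ 0)//; [|lra|lra].
have pib : pi - b <= pi by lra.
have := integral_itv_shift pi pib cF.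
rewrite subrr (_ : pi - b - pi = - b); last by ring.
move=> <-; under eq_integral do rewrite -(Fp (_ - pi)) subrK.
by rewrite addeC -integral_itv_split//; lra.
Qed.

Lemma continuous_integrable_itv (F : R -> R) a b : continuous F ->
  leb.-integrable `[a, b] (EFin \o F).
Proof.
move=> cF; apply: continuous_compact_integrable; first exact: segment_compact.
exact: continuous_subspaceT.
Qed.

(* The division by 2 makes this nonnegative for [0 < e <= 1], so that monotone
   convergence applies as [e] tends to 0. *)
Definition log_cos e u : R := - (2^-1 * ln ((cos u ^+ 2 + e) / 2)).

Lemma log_cos_arg_gt0 e u : 0 < e -> 0 < (cos u ^+ 2 + e) / 2.
Proof. by move=> e0; rewrite divr_gt0// ltr_wpDl// sqr_ge0. Qed.

Lemma continuous_log_cos e : 0 < e -> continuous (log_cos e).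
Proof.
move=> e0; rewrite /log_cos; continuity.
apply: continuous_lnr; first by continuity.
by move=> u; exact: log_cos_arg_gt0.
Qed.

Lemma log_cos_ge0 e u : 0 < e <= 1 -> 0 <= log_cos e u.
Proof.
move=> /andP[e0 e1]; rewrite oppr_ge0 pmulr_rle0 ?invr_gt0// ln_le0//.
by have := cos2Dsin2 u; have := sqr_ge0 (sin u); lra.
Qed.

Lemma cosDpi2 u : cos (u + pi) ^+ 2 = cos u ^+ 2 :> R.
Proof. by rewrite cosDpi sqrrN. Qed.

Lemma integral_sin_sqr : (\int[leb]_(t in `[0%R, pi]) (sin t ^+ 2)%:E = (pi / 2)%:E)%E.
Proof.
have pi0 : 0 < pi :> R by exact: pi_gt0.
pose F u : R := (u - sin u * cos u) / 2.
have dF u : is_derive u 1 F (sin u ^+ 2).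
  rewrite /F; apply: is_derive_eq; rewrite /GRing.scale/=.
  transitivity ((1 + sin u ^+ 2 - cos u ^+ 2) / 2); first by field.
  by rewrite cos2sin2; field.
have cf : continuous (fun u => sin u ^+ 2 : R) by continuity.
rewrite (FTC2_continuous pi0 cf dF) /F sinpi sin0 !mul0r !subr0 mul0r subr0.
by [].
Qed.

Lemma integral_lin_sqr a b :
  (\int[leb]_(t in `[0%R, pi]) ((a * cos t + b * sin t) ^+ 2)%:E =
   (pi / 2 * (a ^+ 2 + b ^+ 2))%:E)%E.
Proof.
have pi0 : 0 < pi :> R by exact: pi_gt0.
pose F u : R := a ^+ 2 * ((u + sin u * cos u) / 2) + a * b * sin u ^+ 2 +
  b ^+ 2 * ((u - sin u * cos u) / 2).
have dF u : is_derive u 1 F ((a * cos u + b * sin u) ^+ 2).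
  rewrite /F; apply: is_derive_eq; rewrite /GRing.scale/=.
  transitivity (a ^+ 2 * ((1 - sin u ^+ 2 + cos u ^+ 2) / 2) + 2 * a * b * sin u * cos u
    + b ^+ 2 * ((1 + sin u ^+ 2 - cos u ^+ 2) / 2)); first by field.
  by rewrite sqrrD exprMn exprMn cos2sin2; field.
have cf : continuous (fun u => (a * cos u + b * sin u) ^+ 2 : R) by continuity.
rewrite (FTC2_continuous pi0 cf dF) /F sinpi sin0; congr EFin.
by move: (pi : R) => p; field.
Qed.

(** The dependence on [b] can only be through [cos b ^+ 2], because [sin t ^+ 2] has only the
    frequencies 0 and 2. After a periodic shift, [sin (u + b) ^+ 2] is [cos u ^+ 2], plus
    [cos b ^+ 2] times [sin u ^+ 2 - cos u ^+ 2], plus a cross term; the middle term is integrated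
    by parts. *)
Lemma integral_sin_sqr_log_cos e b : 0 < e <= 1 -> 0 <= b -> b <= pi ->
  (\int[leb]_(t in `[0%R, pi]) (sin t ^+ 2 * log_cos e (t - b))%:E =
   \int[leb]_(u in `[0%R, pi]) (cos u ^+ 2 * log_cos e u)%:E +
   (cos b ^+ 2)%:E * \int[leb]_(u in `[0%R, pi])
      (sin u ^+ 2 * cos u ^+ 2 / (cos u ^+ 2 + e))%:E)%E.
Proof.
move=> e01 b0 bpi; have /andP[e0 e1] := e01.
have pi0 : 0 < pi :> R by exact: pi_gt0.
have ch : continuous (log_cos e) by exact: continuous_log_cos.
have e_neq0 u : cos u ^+ 2 + e != 0 by rewrite gt_eqF// ltr_wpDl// sqr_ge0.
pose N u : R := sin u ^+ 2 * cos u ^+ 2 / (cos u ^+ 2 + e).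
have cN : continuous N.
  by apply: continuous_divr => //; continuity.
have cch : continuous (fun u => cos u ^+ 2 * log_cos e u) by continuity.
pose G u := sin (u + b) ^+ 2 * log_cos e u.
have cG : continuous G by rewrite /G; continuity.
transitivity (\int[leb]_(t in `[0%R, pi]) (G (t - b))%:E)%E.
  by apply: eq_integral => t _; rewrite /G subrK.
rewrite integral_periodic_shift//; last 2 first.
- by move=> u; rewrite mulr_ge0 ?sqr_ge0 ?log_cos_ge0.
- move=> u; rewrite /G /log_cos cosDpi2; congr (_ * _).
  by rewrite addrAC sinDpi sqrrN.
pose w u : R := (cos u ^+ 2 + e) / 2.
(* The first summand is the boundary term of the integration by parts. The second is a primitive of
   the cross term, since [w] has derivative [- (sin u * cos u)] and [w * ln w - w] is a primitive of
   [ln w] in the variable [w]. Both take equal values at 0 and [pi]. *)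
pose Psi u : R := - cos b ^+ 2 * (sin u * cos u * log_cos e u)
  + sin b * cos b * (w u * ln (w u) - w u).
pose psi u : R := G u - cos u ^+ 2 * log_cos e u
  - cos b ^+ 2 * N u.
have cpsi : continuous psi by rewrite /psi; continuity.
have dPsi u : is_derive u 1 Psi (psi u).
  have w0 : 0 < w u by exact: log_cos_arg_gt0.
  have dw : is_derive u 1 w (- (sin u * cos u)).
    rewrite /w; apply: is_derive_eq; rewrite /GRing.scale/=; by field.
  have dl : is_derive u 1 (fun u => ln (w u)) (- (sin u * cos u) / w u).
    have dln := is_derive1_ln w0.
    have dc := is_derive1_comp dln dw; rewrite mulrC; exact: dc.
  have dlc : is_derive u 1 (log_cos e) (- (2^-1 * (- (sin u * cos u) / w u))).
    by rewrite /log_cos; apply: is_derive_eq; rewrite /GRing.scale/=; ring.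
  rewrite /Psi; apply: is_derive_eq; rewrite /GRing.scale/=.
  have hE : log_cos e u = - (2^-1 * ln (w u)) by [].
  have NE : N u = sin u ^+ 2 * cos u ^+ 2 / (2 * w u).
    by rewrite /N /w; congr (_ / _); field.
  have wn0 : w u != 0 by rewrite gt_eqF.
  transitivity ((sin u ^+ 2 * cos b ^+ 2 + 2 * sin u * cos u * sin b * cos b
      + cos u ^+ 2 * sin b ^+ 2 - cos u ^+ 2) * log_cos e u - cos b ^+ 2 * N u).
    rewrite [sin b ^+ 2]sin2cos2 NE hE.
    by move: (w u) wn0 (ln (w u)) => v v0 l; field.
  by rewrite /psi /G sinD; ring.
transitivity (\int[leb]_(u in `[0%R, pi]) ((cos u ^+ 2 * log_cos e u)%:E +
    ((cos b ^+ 2)%:E * (N u)%:E + (psi u)%:E)))%E.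
  by apply: eq_integral => u _; rewrite -EFinM -!EFinD; congr EFin; rewrite /psi; ring.
have mI : measurable (`[0%R, pi] : set (measurableTypeR R)) by [].
have i1 := continuous_integrable_itv 0 pi cch.
have i2 := continuous_integrable_itv 0 pi cN.
have i3 := continuous_integrable_itv 0 pi cpsi.
have i2' := integrableZl mI (cos b ^+ 2) i2.
rewrite (integralD mI i1 (integrableD mI i2' i3)) (integralD mI i2' i3).
rewrite (integralZl mI i2) (FTC2_continuous pi0 cpsi dPsi).
rewrite [X in (_ + (_ + X))%E](_ : _ = 0%E) ?adde0//.
congr EFin; rewrite /Psi /w sinpi sin0 cospi cos0 sqrrN !mul0r subrr//.
Qed.

End trigonometric_integrals.

(** * Removal of the regularisation in the logarithm of the cosine *)

Section log_cos_limit.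
Variable R : realType.
Local Notation leb := (@lebesgue_measure R).
Implicit Types (a b c e u : R).

Definition elog_cos u : \bar R :=
  if cos u == 0 then +oo%E else (log_cos 0 u)%:E.

Let eps (n : nat) : R := harmonic n.

Let eps01 n : 0 < eps n <= 1.
Proof. by rewrite /eps /harmonic/= invr_gt0 ltr0n/= invf_le1// ler1n. Qed.

Let eps_gt0 n : 0 < eps n. Proof. by case/andP : (eps01 n). Qed.

Let eps_le n m : (n <= m)%N -> eps m <= eps n.
Proof. by move=> nm; rewrite /eps /harmonic/= lef_pV2 ?posrE// ler_nat. Qed.

Let log_cos_nd u n m : (n <= m)%N -> log_cos (eps n) u <= log_cos (eps m) u.
Proof.
move=> nm; rewrite /log_cos lerN2 ler_pM2l ?invr_gt0// ler_ln ?posrE ?log_cos_arg_gt0//.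
by rewrite ler_pM2r ?invr_gt0// lerD2l eps_le.
Qed.

Let cvg_log_cos u : (log_cos (eps n) u)%:E @[n --> \oo] --> elog_cos u.
Proof.
rewrite /elog_cos; have [c0|c0] := eqVneq (cos u) 0.
  apply/cvgeyPge => A; near=> n.
  rewrite lee_fin /log_cos c0 expr0n/= add0r.
  have : expR (2 * A) <= n.+1%:R.
    near: n; exists (Num.truncn (expR (2 * A))) => // n /= tn.
    by rewrite ltW// -truncn_le_nat.
  rewrite -[X in _ <= X -> _]lnK ?posrE// ler_expR => h.
  rewrite ln_div ?posrE// /eps /harmonic/= lnV ?posrE//.
  have : 0 <= ln 2 :> R by rewrite ln_ge0// ler1n.
  by move: h; move: (ln 2) (ln n.+1%:R) => x y; lra.
apply: cvg_EFin; first exact: nearW.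
rewrite /log_cos; apply: cvgN; apply: cvgM; first exact: cvg_cst.
have w0 : 0 < (cos u ^+ 2 + 0) / 2.
  by rewrite divr_gt0// addr0 exprn_even_gt0.
apply: (@cvg_comp _ _ _ (fun n => (cos u ^+ 2 + eps n) / 2) (@ln R) _ _ _ _ (continuous_ln w0)).
apply: cvgM; last exact: cvg_cst.
by apply: cvgD; [exact: cvg_cst|exact: cvg_harmonic].
Unshelve. all: by end_near. Qed.

Let sinlog n b t : R := sin t ^+ 2 * log_cos (eps n) (t - b).

Let continuous_sinlog n b : continuous (sinlog n b).
Proof.
have ch := continuous_log_cos (eps_gt0 n).
rewrite /sinlog; continuity.
move=> x; apply: (continuous_comp (f := fun t => t - b)); last exact: ch.
by have c : continuous (fun t : R => t - b); [continuity|exact: c].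
Qed.

Let cvg_sinlog b :
  (\int[leb]_(t in `[0%R, pi]) (sinlog n b t)%:E @[n --> \oo] -->
   \int[leb]_(t in `]0%R, pi[) ((sin t ^+ 2)%:E * elog_cos (t - b)))%E.
Proof.
have mI : measurable (`]0%R, pi[ : set (measurableTypeR R)) by [].
have m n : measurable_fun setT (sinlog n b).
  by apply: continuous_measurable_fun; exact: continuous_sinlog.
have -> : (fun n => \int[leb]_(t in `[0%R, pi]) (sinlog n b t)%:E)%E =
    (fun n => \int[leb]_(t in `]0%R, pi[) (sinlog n b t)%:E)%E.
  apply/funext => n; apply: (@integral_itv_bndoo R _ _ (EFin \o sinlog n b) true false).
  exact/measurable_EFinP/measurable_funTS.
have cvg_t t : `]0%R, pi[%classic t ->
    (sinlog n b t)%:E @[n --> \oo] --> ((sin t ^+ 2)%:E * elog_cos (t - b))%E.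
  move=> _; rewrite /sinlog; under eq_fun do rewrite EFinM.
  by apply: cvgeZl => //; exact: cvg_log_cos.
have -> : (\int[leb]_(t in `]0%R, pi[) ((sin t ^+ 2)%:E * elog_cos (t - b)) =
    \int[leb]_(t in `]0%R, pi[) limn (fun n => (sinlog n b t)%:E))%E.
  by apply: eq_integral => t /set_mem It; apply/esym/cvg_lim => //; exact: cvg_t.
apply: cvg_monotone_convergence => //.
- by move=> n; apply/measurable_EFinP; apply: measurable_funTS; exact: m.
- by move=> n t _; rewrite lee_fin mulr_ge0 ?sqr_ge0 ?log_cos_ge0.
- by move=> t _ n p np; rewrite lee_fin ler_wpM2l ?sqr_ge0// log_cos_nd.
Qed.

Let NN n u : R := sin u ^+ 2 * cos u ^+ 2 / (cos u ^+ 2 + eps n).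

Let cvg_NN : (\int[leb]_(u in `[0%R, pi]) (NN n u)%:E @[n --> \oo] --> (pi / 2)%:E)%E.
Proof.
have pi0 : 0 < pi :> R by exact: pi_gt0.
have mI : measurable (`[0%R, pi] : set (measurableTypeR R)) by [].
have d0 n u : 0 < cos u ^+ 2 + eps n by rewrite ltr_wpDl// sqr_ge0.
have mN n : measurable_fun (`[0%R, pi] : set (measurableTypeR R)) (EFin \o NN n).
  apply/measurable_EFinP/measurable_funTS; apply: continuous_measurable_fun.
  by apply: continuous_divr; [by continuity|by continuity|move=> u; rewrite gt_eqF].
rewrite -integral_sin_sqr.
have := @dominated_convergence _ _ _ leb `[0%R, pi]%classic mI
  (fun n u => (NN n u)%:E) (fun u => (sin u ^+ 2)%:E) (cst 1%E) mN.
case.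
- by apply/measurable_EFinP/measurable_funTS; apply: continuous_measurable_fun; continuity.
(* At [pi / 2] every [NN n] is 0 while the limit function is 1; this point is the exceptional null
   set. *)
- exists [set pi / 2]; split; first exact: measurable_set1.
    exact: lebesgue_measure_set1.
  move=> u /= h; apply: contrapT => u2; apply: h => uI.
  have cu : cos u != 0.
    apply/eqP => cu; apply: u2; apply: (@cos_inj R) => //; last by rewrite cu cos_pihalf.
    by rewrite in_itv/=; lra.
  apply: cvg_EFin; first exact: nearW.
  have <- : sin u ^+ 2 * cos u ^+ 2 / (cos u ^+ 2 + 0) = sin u ^+ 2.
    by rewrite addr0 mulfK// expf_neq0.
  apply: cvgM; first exact: cvg_cst.
  apply: cvgV; first by rewrite addr0 expf_neq0.
  by apply: cvgD; [exact: cvg_cst|exact: cvg_harmonic].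
- have := @continuous_integrable_itv R (cst 1) 0 pi.
  by apply; exact: continuous_cstr.
- apply: aeW => u n _; rewrite lee_fin ger0_norm.
    rewrite ler_pdivrMr// mul1r; have := cos2Dsin2 u.
    have := sqr_ge0 (cos u); have := sqr_ge0 (sin u); have := eps_gt0 n.
    by move: (cos u ^+ 2) (sin u ^+ 2) => x y *; nra.
  by rewrite mulr_ge0 ?invr_ge0 ?(ltW (d0 _ _))// mulr_ge0 ?sqr_ge0.
by move=> _ _.
Qed.

Lemma log_cos0_ge0 u : 0 <= log_cos 0 u.
Proof.
rewrite oppr_ge0 pmulr_rle0 ?invr_gt0// ln_le0//.
by have := cos2Dsin2 u; have := sqr_ge0 (sin u); lra.
Qed.

Lemma elog_cos_ge0 u : (0 <= elog_cos u)%E.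
Proof. by rewrite /elog_cos; case: ifPn => _; rewrite ?leey// lee_fin log_cos0_ge0. Qed.

Lemma measurable_log_cos0 c : measurable_fun setT (fun t : R => log_cos 0 (t - c)).
Proof.
apply: measurable_funN; apply: measurable_funM => //.
apply: (measurableT_comp (@measurable_ln R)); apply: continuous_measurable_fun.
by continuity.
Qed.

Lemma measurable_elog_cos c : measurable_fun setT (fun t : R => elog_cos (t - c)).
Proof.
have mc : measurable_fun setT (fun t : R => cos (t - c)).
  by apply: continuous_measurable_fun; continuity.
apply: measurable_fun_ifT.
- by apply: measurable_fun_eqr.
- exact: measurable_cst.
- by apply/measurable_EFinP; exact: measurable_log_cos0.
Qed.

Lemma elog_cosB_pihalf t : `]0%R, pi[%classic t ->
  elog_cos (t - pi / 2) = (log_cos 0 (t - pi / 2))%:E.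
Proof.
rewrite /= in_itv/= => t0pi.
by rewrite /elog_cos cosBpihalf gt_eqF// sin_gt0_pi.
Qed.

(** The weight tames the logarithm: with y = [sin t ^+ 2] the integrand is y ln (2 / y) / 2, at most
    1 - y / 2. *)
Lemma integral_sin_sqr_elog_cos_pihalf_lty :
  (\int[leb]_(t in `]0%R, pi[) ((sin t ^+ 2)%:E * elog_cos (t - pi / 2)) < +oo)%E.
Proof.
have mI : measurable (`]0%R, pi[ : set (measurableTypeR R)) by [].
have ms : measurable_fun setT (fun t : R => sin t ^+ 2).
  by apply: continuous_measurable_fun; continuity.
apply: (@le_lt_trans _ _ (\int[leb]_(t in `]0%R, pi[) 1)%E).
  apply: ge0_le_integral => //.
  - by move=> t _; rewrite mule_ge0 ?elog_cos_ge0// lee_fin sqr_ge0.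
  - apply: measurable_funTS; apply: emeasurable_funM; first exact/measurable_EFinP.
    exact: measurable_elog_cos.
  - move=> t It; rewrite elog_cosB_pihalf// -EFinM lee_fin.
    rewrite /log_cos cosBpihalf addr0.
    have s0 : 0 < sin t by move: It; rewrite /= in_itv/=; exact: sin_gt0_pi.
    have y0 : 0 < sin t ^+ 2 by rewrite exprn_gt0.
    have y1 : sin t ^+ 2 <= 1 by have := cos2Dsin2 t; have := sqr_ge0 (cos t); lra.
    move: (sin t ^+ 2) y0 y1 => y y0 y1.
    have := @ln_le R (2 / y); rewrite divr_gt0// => /(_ isT).
    have -> : ln (y / 2) = - ln (2 / y).
      by rewrite -lnV ?posrE ?divr_gt0// invf_div.
    move: (ln (2 / y)) => l hl.
    have : y * l <= y * (2 / y - 1) by rewrite ler_pM2l.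
    rewrite mulrBr mulrCA mulfV ?gt_eqF// => ?; nra.
have e : leb `]0%R, pi[%classic = pi%:E.
  by rewrite lebesgue_measure_itv/= lte_fin pi_gt0 sube0.
by rewrite integral_cst// mul1e [ltLHS]e ltry.
Qed.

(** The constant part is eliminated by comparison with the angle [pi / 2], where [cos b] vanishes,
    and its value is never computed. At this angle the integrand contains [- ln (sin t)], the very
    term created by the division by [sin t] in [slope]. *)
Lemma integral_sin_sqr_elog_cos b : 0 <= b -> b <= pi ->
  (\int[leb]_(t in `]0%R, pi[) ((sin t ^+ 2)%:E * elog_cos (t - b)) =
   \int[leb]_(t in `]0%R, pi[) ((sin t ^+ 2)%:E * elog_cos (t - pi / 2)) +
   (cos b ^+ 2 * (pi / 2))%:E)%E.
Proof.
move=> b0 bpi; have pi0 : 0 < pi :> R by exact: pi_gt0.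
have fin2 : (\int[leb]_(t in `]0%R, pi[) ((sin t ^+ 2)%:E * elog_cos (t - pi / 2)) \is a fin_num)%E.
  rewrite ge0_fin_numE ?integral_sin_sqr_elog_cos_pihalf_lty//.
  apply: integral_ge0 => t _; rewrite mule_ge0 ?elog_cos_ge0// lee_fin sqr_ge0//.
have E n c : 0 <= c -> c <= pi -> (\int[leb]_(t in `[0%R, pi]) (sinlog n c t)%:E =
   \int[leb]_(u in `[0%R, pi]) (cos u ^+ 2 * log_cos (eps n) u)%:E +
   (cos c ^+ 2)%:E * \int[leb]_(u in `[0%R, pi]) (NN n u)%:E)%E.
  by move=> c0 cpi; rewrite /sinlog integral_sin_sqr_log_cos.
have E2 n : (\int[leb]_(t in `[0%R, pi]) (sinlog n b t)%:E =
   \int[leb]_(t in `[0%R, pi]) (sinlog n (pi / 2) t)%:E +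
   (cos b ^+ 2)%:E * \int[leb]_(u in `[0%R, pi]) (NN n u)%:E)%E.
  rewrite E// [in RHS]E; [|lra|lra].
  by rewrite cos_pihalf expr0n/= mul0e adde0.
have := @cvg_sinlog b; under eq_fun do rewrite E2.
move=> h; rewrite -(cvg_lim (@ereal_hausdorff R) h); apply/cvg_lim => //.
rewrite (EFinM (cos b ^+ 2)); apply: cvgeD; first by rewrite fin_num_adde_defr.
  exact: cvg_sinlog.
by apply: cvgeZl => //; exact: cvg_NN.
Qed.

End log_cos_limit.

(** * The planar kernel as an average over shear directions *)

Section kernel_average.
Variable R : realType.
Local Notation leb := (@lebesgue_measure R).
Local Notation I := `]0%R, (pi : R)[%classic.

(* Shear coordinate of [x] along the direction of angle [t]: the orthogonal
   projection of [x] onto [(cos t, sin t)], divided by [sin t]. *)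
Definition slope (t : R) (x : plane R) : R := x.2 + x.1 * (cos t / sin t).

Lemma log_kernelC (x y : R) : log_kernel x y = log_kernel y x.
Proof. by rewrite /log_kernel eq_sym distrC [y ^+ 2 + _]addrC. Qed.

Lemma integral_oo_cc (f : R -> R) : continuous f ->
  (\int[leb]_(t in I) (f t)%:E = \int[leb]_(t in `[0%R, pi]) (f t)%:E)%E.
Proof.
move=> cf; apply/esym; apply: (@integral_itv_bndoo R _ _ (EFin \o f) true false).
by apply/measurable_EFinP/measurable_funTS; exact: continuous_measurable_fun.
Qed.

Lemma measurable_slope : measurable_fun setT (fun p : measurableTypeR R * plane R => slope p.1 p.2).
Proof.
have m2 : measurable_fun setT (fun p : measurableTypeR R * plane R => p.2) := measurable_snd.
apply: measurable_funD; first exact: (measurableT_comp measurable_snd m2).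
apply: measurable_funM; first exact: (measurableT_comp measurable_fst m2).
have mc : measurable_fun setT (fun t : R => cos t / sin t).
  apply: measurable_funM; first by apply: continuous_measurable_fun; exact: continuous_cos.
  by apply: measurable_funV; apply: continuous_measurable_fun; exact: continuous_sin.
exact: (measurableT_comp mc measurable_fst).
Qed.

Section upper_half_plane.
Variables x y : plane R.
Let z := (x - y)%R.
Let rho := Num.sqrt (sqnorm z).
Hypothesis z_neq0 : z != 0.
Hypothesis z2_ge0 : 0 <= z.2.

Let sqn0 : 0 < sqnorm z.
Proof.
rewrite lt0r addr_ge0 ?sqr_ge0// andbT paddr_eq0 ?sqr_ge0// !sqrf_eq0.
by apply: contra z_neq0 => /andP[/eqP e1 /eqP e2]; apply/eqP/pair_equal_spec.
Qed.

Let rho_gt0 : 0 < rho. Proof. by rewrite sqrtr_gt0. Qed.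

Let rho2 : rho ^+ 2 = sqnorm z. Proof. by rewrite sqr_sqrtr// ltW. Qed.

(** The polar angle of [z]. [acos] gives it only when [z.2] is nonnegative, which is why the section
    works in the upper half plane. *)
Let b := acos (z.1 / rho).

Let z1rho : -1 <= z.1 / rho <= 1.
Proof.
rewrite -ler_norml -(@ler_pXn2r _ 2)// ?nnegrE// expr1n real_normK ?num_real//.
rewrite exprMn exprVn rho2 ler_pdivrMr// mul1r /sqnorm lerDl sqr_ge0//.
Qed.

Let cosb : cos b = z.1 / rho.
Proof. by rewrite /b acosK// in_itv. Qed.

Let sinb : sin b = z.2 / rho.
Proof.
rewrite /b sin_acos//.
have -> : 1 - (z.1 / rho) ^+ 2 = (z.2 / rho) ^+ 2.
  rewrite !exprMn exprVn rho2 -(divff (lt0r_neq0 sqn0)) -mulrBl; congr (_ / _).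
  by rewrite /sqnorm addrC addKr.
by rewrite sqrtr_sqr ger0_norm// divr_ge0// ltW.
Qed.

(** The last term vanishes unless [sin t = 0]; with it the identity is polynomial in the inverse of
    [sin t] and holds for every [t]. *)
Let slopeB t : slope t x - slope t y = rho * cos (t - b) / sin t + z.2 * (1 - sin t / sin t).
Proof.
have rn : rho != 0 by rewrite gt_eqF.
rewrite cosB cosb sinb /slope /z /=.
move: (sin t)^-1 => s; field => //.
Qed.

Let l := ln rho.

(** The logarithm of the slope difference is [l + ln |cos (t - b)| - ln (sin t)]. Terms are placed
    on the side where they are nonnegative, and [|l| * sin t ^+ 2] is added to both sides because
    the sign of [l] is unknown. If [cos (t - b) = 0] the slopes coincide and both sides are
    [+oo]. *)
Let pointwise t : I t ->
  ((sin t ^+ 2)%:E * log_kernel (slope t x) (slope t y) +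
    (sin t ^+ 2 * log_cos 0 (t - pi / 2) + `|l| * sin t ^+ 2)%:E =
   (sin t ^+ 2)%:E * elog_cos (t - b) + ((`|l| - l) * sin t ^+ 2 +
     2^-1 * ((x.1 * cos t + x.2 * sin t) ^+ 2 + (y.1 * cos t + y.2 * sin t) ^+ 2))%:E)%E.
Proof.
rewrite /= in_itv/= => It; have s0 : 0 < sin t by exact: sin_gt0_pi.
have sn0 : sin t != 0 by rewrite gt_eqF.
have := slopeB t; rewrite divff// subrr mulr0 addr0 => sB.
rewrite /elog_cos; have [c0|c0] := eqVneq (cos (t - b)) 0.
  have -> : slope t x = slope t y.
    by apply/eqP; rewrite -subr_eq0 sB c0 mulr0 mul0r.
  by rewrite /log_kernel eqxx !gt0_muley ?lte_fin ?exprn_gt0// !addye.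
rewrite /log_kernel -subr_eq0 sB !mulf_eq0 invr_eq0 (gt_eqF rho_gt0) (gt_eqF s0) (negbTE c0)/=.
rewrite -!EFinM -!EFinD; congr EFin.
have -> : ln `|rho * cos (t - b) / sin t| = l + ln `|cos (t - b)| - ln (sin t).
  rewrite normrM normfV normrM (gtr0_norm s0) (gtr0_norm rho_gt0).
  by rewrite ln_div ?posrE ?mulr_gt0 ?normr_gt0// lnM ?posrE ?normr_gt0.
have lc (u : R) : cos u != 0 -> log_cos 0 u = - ln `|cos u| + 2^-1 * ln 2.
  move=> u0; rewrite /log_cos addr0 -[cos u ^+ 2]real_normK ?num_real//.
  rewrite ln_div ?posrE ?exprn_gt0 ?normr_gt0// lnXn ?normr_gt0//.
  by rewrite (mulr2n (ln _)); move: (ln `|cos u|) (ln 2) => A B; field.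
have lc2 : log_cos 0 (t - pi / 2) = - ln (sin t) + 2^-1 * ln 2.
  by rewrite lc cosBpihalf// (gtr0_norm s0).
rewrite lc2 (lc (t - b) c0) /slope.
move: (ln (sin t)) (ln `|cos (t - b)|) (ln 2) => A B C.
by field.
Qed.

(** The reference integral [C0] occurs on both sides and cancels because it is finite. The factor
    [pi / 2] is common to the integral of [sin t ^+ 2], to the coefficient of [cos b ^+ 2] and to
    the confinement, so the anisotropic term gets coefficient exactly 1. *)
Lemma kernel_average_upper :
  (\int[leb]_(t in I) ((sin t ^+ 2)%:E * log_kernel (slope t x) (slope t y)) =
   (pi / 2)%:E * (W 1 (x - y)%R + (2^-1 * (sqnorm x + sqnorm y))%R%:E))%E.
Proof.
have mI : measurable (I : set (measurableTypeR R)) by [].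
have pi0 : 0 < pi :> R by exact: pi_gt0.
have b0 : 0 <= b by exact: acos_ge0.
have bpi : b <= pi by exact: acos_lepi.
have ms : measurable_fun setT (fun t : R => sin t ^+ 2).
  by apply: continuous_measurable_fun; continuity.
have mE : measurable_fun setT (EFin \o (fun t : R => sin t ^+ 2)) by exact/measurable_EFinP.
have msl (w : plane R) : measurable_fun setT (slope ^~ w).
  exact: (measurable_fun_pair1 w measurable_slope).
have mk : measurable_fun setT (fun t => log_kernel (slope t x) (slope t y)).
  have m2 : measurable_fun setT (fun t => (slope t x, slope t y) : plane R).
    by apply/measurable_fun_pair; exact: msl.
  exact: (measurableT_comp (@measurable_log_kernel R) m2).
have s0 (t : R) : 0 <= sin t ^+ 2 by exact: sqr_ge0.
have se0 (t : R) : (0 <= (sin t ^+ 2)%:E)%E by rewrite lee_fin.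
have mlc : measurable_fun setT (fun t : R => sin t ^+ 2 * log_cos 0 (t - pi / 2)).
  by apply: measurable_funM => //; exact: measurable_log_cos0.
have lc0 t : 0 <= sin t ^+ 2 * log_cos 0 (t - pi / 2) :> R.
  by rewrite mulr_ge0// log_cos0_ge0.
set X := (\int[leb]_(t in I) _)%E.
pose C0 := (\int[leb]_(t in I) ((sin t ^+ 2)%:E * elog_cos (t - pi / 2)))%E.
have C0E : (\int[leb]_(t in I) (sin t ^+ 2 * log_cos 0 (t - pi / 2))%:E)%E = C0.
  by apply: eq_integral => t /set_mem It; rewrite elog_cosB_pihalf// EFinM.
have C0fin : C0 \is a fin_num.
  rewrite ge0_fin_numE ?integral_sin_sqr_elog_cos_pihalf_lty//.
  by apply: integral_ge0 => t _; rewrite mule_ge0 ?elog_cos_ge0.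
have sinE (k : R) : (0 <= k)%R -> (\int[leb]_(t in I) (k * sin t ^+ 2)%:E = (k * (pi / 2))%:E)%E.
  move=> k0; under eq_integral do rewrite EFinM.
  rewrite ge0_integralZl_EFin//; last exact: measurable_funTS.
  rewrite integral_oo_cc; last by continuity.
  by rewrite integral_sin_sqr EFinM.
have linE (w : plane R) : (\int[leb]_(t in I) ((w.1 * cos t + w.2 * sin t) ^+ 2)%:E =
    (pi / 2 * sqnorm w)%:E)%E.
  by rewrite integral_oo_cc ?integral_lin_sqr//; continuity.
have mlin (w : plane R) : measurable_fun setT (fun t : R => (w.1 * cos t + w.2 * sin t) ^+ 2).
  by apply: continuous_measurable_fun; continuity.
have : (\int[leb]_(t in I) ((sin t ^+ 2)%:E * log_kernel (slope t x) (slope t y) +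
    (sin t ^+ 2 * log_cos 0 (t - pi / 2) + `|l| * sin t ^+ 2)%:E) =
  \int[leb]_(t in I) ((sin t ^+ 2)%:E * elog_cos (t - b) + ((`|l| - l) * sin t ^+ 2 +
     2^-1 * ((x.1 * cos t + x.2 * sin t) ^+ 2 + (y.1 * cos t + y.2 * sin t) ^+ 2))%:E))%E.
  by apply: eq_integral => t /set_mem It; exact: pointwise.
have ll : 0 <= `|l| - l by rewrite subr_ge0 ler_norm.
rewrite ge0_integralD//; last 4 first.
- by move=> t _; rewrite mule_ge0 ?log_kernel_ge0.
- by apply: measurable_funTS; exact: emeasurable_funM.
- by move=> t _; rewrite lee_fin addr_ge0// mulr_ge0.
- apply/measurable_EFinP/measurable_funTS; apply: measurable_funD => //.
  exact: measurable_funM.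
rewrite -/X.
have -> : (\int[leb]_(t in I) (sin t ^+ 2 * log_cos 0 (t - pi / 2) + `|l| * sin t ^+ 2)%:E =
    C0 + (`|l| * (pi / 2))%:E)%E.
  under eq_integral do rewrite EFinD.
  rewrite ge0_integralD; last 5 first.
  - exact: mI.
  - by move=> t _; rewrite lee_fin.
  - by apply/measurable_EFinP/measurable_funTS.
  - by move=> t _; rewrite lee_fin mulr_ge0.
  - by apply/measurable_EFinP/measurable_funTS; exact: measurable_funM.
  by rewrite C0E sinE.
rewrite ge0_integralD//; last 4 first.
- by move=> t _; rewrite mule_ge0 ?elog_cos_ge0.
- by apply: measurable_funTS; apply: emeasurable_funM => //; exact: measurable_elog_cos.
- move=> t _; rewrite lee_fin; apply: addr_ge0; first exact: mulr_ge0.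
  by apply: mulr_ge0; [rewrite invr_ge0|apply: addr_ge0; exact: sqr_ge0].
- apply/measurable_EFinP/measurable_funTS; apply: measurable_funD => //.
    exact: measurable_funM.
  apply: measurable_funM; first exact: measurable_cst.
  exact: (measurable_funD (mlin x) (mlin y)).
rewrite integral_sin_sqr_elog_cos// -/C0.
have -> : (\int[leb]_(t in I) ((`|l| - l) * sin t ^+ 2 +
     2^-1 * ((x.1 * cos t + x.2 * sin t) ^+ 2 + (y.1 * cos t + y.2 * sin t) ^+ 2))%:E =
   ((`|l| - l) * (pi / 2) + 2^-1 * (pi / 2 * sqnorm x + pi / 2 * sqnorm y))%:E)%E.
  under eq_integral do rewrite EFinD.
  rewrite ge0_integralD//; last 4 first.
  - by move=> t _; rewrite lee_fin mulr_ge0.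
  - by apply/measurable_EFinP/measurable_funTS; exact: measurable_funM.
  - by move=> t _; rewrite lee_fin mulr_ge0 ?invr_ge0// addr_ge0 ?sqr_ge0.
  - apply/measurable_EFinP/measurable_funTS.
    apply: measurable_funM; first exact: measurable_cst.
    exact: (measurable_funD (mlin x) (mlin y)).
  rewrite sinE// EFinD; congr (_ + _)%E.
  under eq_integral do rewrite EFinM.
  rewrite ge0_integralZl_EFin ?invr_ge0//; last 2 first.
  - by move=> t _; rewrite lee_fin addr_ge0 ?sqr_ge0.
  - apply/measurable_EFinP/measurable_funTS.
    exact: (measurable_funD (mlin x) (mlin y)).
  under eq_integral do rewrite EFinD.
  rewrite ge0_integralD//; last 4 first.
  - by move=> t _; rewrite lee_fin sqr_ge0.
  - by apply/measurable_EFinP; apply: measurable_funTS; exact: (mlin x).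
  - by move=> t _; rewrite lee_fin sqr_ge0.
  - by apply/measurable_EFinP; apply: measurable_funTS; exact: (mlin y).
  by rewrite !linE -EFinD -EFinM.
have WE : W 1 (x - y)%R = (- l + cos b ^+ 2)%:E.
  rewrite /W -/z (negbTE z_neq0); congr EFin.
  rewrite cosb exprMn exprVn rho2 mul1r; congr (- _ + _).
  by rewrite /l -rho2 lnXn// (mulr2n (ln _)); move: (ln rho) => A; field.
rewrite WE -EFinD -EFinM -(fineK C0fin).
have X0 : (0 <= X)%E by apply: integral_ge0 => t _; rewrite mule_ge0 ?log_kernel_ge0.
clearbody X; case: X X0 => [r _| |]//.
rewrite -!EFinD => h; have := EFin_inj h => {}h; congr EFin.
move: (pi : R) h => p h; lra.
Qed.

End upper_half_plane.

Lemma sqnormN (z : plane R) : sqnorm (- z) = sqnorm z.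
Proof. by rewrite /sqnorm /= !sqrrN. Qed.

Lemma WN (alpha : R) (z : plane R) : W alpha (- z) = W alpha z.
Proof. by rewrite /W oppr_eq0 sqnormN /= sqrrN. Qed.

Lemma kernel_average (x y : plane R) :
  (\int[leb]_(t in I) ((2 / pi * sin t ^+ 2)%:E * log_kernel (slope t x) (slope t y)) =
   W 1 (x - y)%R + (2^-1 * (sqnorm x + sqnorm y))%R%:E)%E.
Proof.
have pi0 : 0 < pi :> R by exact: pi_gt0.
have mI : measurable (I : set (measurableTypeR R)) by [].
have msl (w : plane R) : measurable_fun setT (slope ^~ w).
  exact: (measurable_fun_pair1 w measurable_slope).
have mk : measurable_fun setT (fun t => log_kernel (slope t x) (slope t y)).
  have m2 : measurable_fun setT (fun t => (slope t x, slope t y) : plane R).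
    by apply/measurable_fun_pair; exact: msl.
  exact: (measurableT_comp (@measurable_log_kernel R) m2).
have ms : measurable_fun setT (fun t : R => (sin t ^+ 2)%:E).
  by apply/measurable_EFinP; apply: continuous_measurable_fun; continuity.
transitivity ((2 / pi)%:E *
    \int[leb]_(t in I) ((sin t ^+ 2)%:E * log_kernel (slope t x) (slope t y)))%E.
  rewrite -ge0_integralZl_EFin//.
  - by apply: eq_integral => t _; rewrite muleA -EFinM.
  - by move=> t _; rewrite mule_ge0 ?log_kernel_ge0// lee_fin sqr_ge0.
  - by apply: measurable_funTS; exact: emeasurable_funM.
  - by rewrite divr_ge0// ltW.
have cancel (X : \bar R) : ((2 / pi)%:E * ((pi / 2)%:E * X) = X)%E.
  rewrite muleA -EFinM (_ : 2 / pi * (pi / 2) = 1) ?mul1e//.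
  by rewrite mulrA divfK ?gt_eqF// divff.
have [xy|xy] := eqVneq (x - y) 0.
  rewrite /W xy eqxx addye// (_ : \int[leb]_(t in I) _ = +oo)%E.
    by rewrite gt0_muley// lte_fin divr_gt0.
  have -> : x = y by apply/eqP; rewrite -subr_eq0 xy.
  rewrite (eq_integral (cst +oo)%E); last first.
    move=> t /set_mem; rewrite /= in_itv/= => It; rewrite /log_kernel eqxx gt0_muley//.
    by rewrite lte_fin exprn_gt0// sin_gt0_pi.
  have e : leb I = pi%:E by rewrite lebesgue_measure_itv/= lte_fin pi0 sube0.
  by rewrite integral_cst// [X in (_ * X)%E]e gt0_mulye.
have [z2|z2] := leP 0 (x - y).2.
  by rewrite kernel_average_upper ?cancel.
(* Both kernels are symmetric in [x] and [y]; exchanging them moves the difference to the upper half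
   plane. *)
under eq_integral do rewrite log_kernelC.
rewrite kernel_average_upper ?cancel.
- by rewrite -opprB WN [sqnorm y + _]addrC.
- by rewrite -opprB oppr_eq0.
- by move: z2; rewrite /= => ?; lra.
Qed.

End kernel_average.

(** * Minimisers in the plane *)

Section minimiser.
Variable R : realType.
Local Notation leb := (@lebesgue_measure R).
Local Notation sc := (@semicircle R).
Local Notation I := `]0%R, (pi : R)[%classic.
Local Notation L := (\int[sc \x sc]_z log_kernel z.1 z.2)%E.

(** A probability density on the whole line: the indicator lets Tonelli run over full spaces. *)
Let w (t : R) : R := \1_I t * (2 / pi * sin t ^+ 2).

Let w_ge0 t : 0 <= w t.
Proof.
by rewrite mulr_ge0 ?indicE ?ler0n// mulr_ge0 ?sqr_ge0// divr_ge0// pi_ge0.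
Qed.

Let w_gt0 t : I t -> 0 < w t.
Proof.
move=> It; rewrite /w indicE mem_set// mul1r mulr_gt0 ?divr_gt0 ?pi_gt0//.
by rewrite exprn_gt0// sin_gt0_pi//; move: It; rewrite /= in_itv.
Qed.

Let measurable_w : measurable_fun setT w.
Proof.
apply: measurable_funM; first exact: measurable_indic.
apply: measurable_funM; first exact: measurable_cst.
by apply: continuous_measurable_fun; continuity.
Qed.

Let integral_w (f : R -> \bar R) :
  (\int[leb]_t ((w t)%:E * f t) = \int[leb]_(t in I) ((2 / pi * sin t ^+ 2)%:E * f t))%E.
Proof.
rewrite [RHS]integral_mkcond; apply: eq_integral => t _.
rewrite /w patchE indicE; case: ifPn => It; first by rewrite mul1r.
by rewrite mul0r mul0e.
Qed.

Let w1 : (\int[leb]_t (w t)%:E = 1)%E.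
Proof.
under eq_integral do rewrite -(mule1 (w _)%:E).
rewrite (integral_w (cst 1%E)) /=; under eq_integral do rewrite mule1.
rewrite integral_oo_cc; last by continuity.
under eq_integral do rewrite EFinM.
rewrite ge0_integralZl_EFin//; first last.
- by rewrite divr_ge0// pi_ge0.
- apply/measurable_EFinP; apply: measurable_funTS.
  by apply: continuous_measurable_fun; continuity.
- by move=> t _; rewrite lee_fin sqr_ge0.
rewrite integral_sin_sqr -EFinM; congr EFin.
have := pi_gt0 R; move: (pi : R) => p p0; field; exact: lt0r_neq0.
Qed.

Section average.
Variable nu : probability (plane R) R.

Let Lam t := (\int[nu \x nu]_z log_kernel (slope t z.1) (slope t z.2))%E.

Let F (q : (plane R * plane R) * measurableTypeR R) : \bar R :=
  ((w q.2)%:E * log_kernel (slope q.2 q.1.1) (slope q.2 q.1.2))%E.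

Let nu2 : probability (plane R * plane R)%type R := (nu \x nu)%E.

Let F_ge0 q : (0 <= F q)%E.
Proof. by rewrite /F mule_ge0 ?lee_fin ?log_kernel_ge0. Qed.

Let measurable_F : measurable_fun setT F.
Proof.
have m1 : measurable_fun setT (fun q : (plane R * plane R) * measurableTypeR R => q.1)
  := measurable_fst.
have m2 : measurable_fun setT (fun q : (plane R * plane R) * measurableTypeR R => q.2)
  := measurable_snd.
have ms (p : plane R * plane R -> plane R) : measurable_fun setT p ->
  measurable_fun setT (fun q : (plane R * plane R) * measurableTypeR R => slope q.2 (p q.1)).
  move=> mp.
  have mq : measurable_fun setT (fun q : (plane R * plane R) * measurableTypeR R => (q.2, p q.1)).
    by apply/measurable_fun_pair => //; exact: (measurableT_comp mp m1).
  exact: (measurableT_comp (@measurable_slope R) mq).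
apply: emeasurable_funM.
  by apply/measurable_EFinP; exact: (measurableT_comp measurable_w m2).
have mk : measurable_fun setT (fun q : (plane R * plane R) * measurableTypeR R =>
   (slope q.2 q.1.1, slope q.2 q.1.2) : plane R).
  apply/measurable_fun_pair.
    exact: (ms fst measurable_fst).
  exact: (ms snd measurable_snd).
exact: (measurableT_comp (@measurable_log_kernel R) mk).
Qed.

Let measurable_slope_at t : measurable_fun setT (slope t : plane R -> measurableTypeR R).
Proof. exact: (measurable_fun_pair2 t (@measurable_slope R)). Qed.

Let measurable_kernel_at t :
  measurable_fun setT (fun z : plane R * plane R => log_kernel (slope t z.1) (slope t z.2)).
Proof.
have mk : measurable_fun setT (fun z : plane R * plane R =>
   (slope t z.1, slope t z.2) : plane R).
  apply/measurable_fun_pair.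
    exact: (measurableT_comp (measurable_slope_at t) measurable_fst).
  exact: (measurableT_comp (measurable_slope_at t) measurable_snd).
exact: (measurableT_comp (@measurable_log_kernel R) mk).
Qed.

Let F_Lam t : (\int[nu \x nu]_z F (z, t) = (w t)%:E * Lam t)%E.
Proof.
rewrite /F /= ge0_integralZl_EFin// => z _; exact: log_kernel_ge0.
Qed.

Lemma energy_average :
  (\int[nu \x nu]_z (W 1 (z.1 - z.2)%R + (2^-1 * (sqnorm z.1 + sqnorm z.2))%R%:E) =
   \int[leb]_t ((w t)%:E * \int[nu \x nu]_z log_kernel (slope t z.1) (slope t z.2)))%E.
Proof.
transitivity (\int[nu \x nu]_z \int[leb]_t F (z, t))%E.
  apply: eq_integral => z _; rewrite -kernel_average /F /=.
  by rewrite (integral_w (fun t => log_kernel (slope t z.1) (slope t z.2))).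
rewrite (@fubini_tonelli _ _ (plane R * plane R)%type (measurableTypeR R) R nu2
   leb F measurable_F F_ge0).
by apply: eq_integral => t _; exact: F_Lam.
Qed.

Lemma measurable_average :
  measurable_fun setT
    (fun t => (w t)%:E * \int[nu \x nu]_z log_kernel (slope t z.1) (slope t z.2))%E.
Proof.
have := @measurable_fun_fubini_tonelli_G _ _ (plane R * plane R)%type
  (measurableTypeR R) R nu2 F measurable_F F_ge0.
by apply: eq_measurable_fun => t _; rewrite /fubini_G F_Lam.
Qed.

Lemma slope_distribution t :
  exists rho : probability (measurableTypeR R) R,
    (forall A, rho A = nu (slope t @^-1` A)) /\
    (\int[nu \x nu]_z log_kernel (slope t z.1) (slope t z.2) =
     \int[rho \x rho]_z log_kernel z.1 z.2)%E.
Proof.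
have [rho rhoE] := @exists_distribution _ _ _ (measurableTypeR R) R nu
  (slope t) (measurable_slope_at t).
exists rho; split=> //; apply/esym.
rewrite (@ge0_integral_image2 _ _ _ _ R nu rho _ (measurable_slope_at t) _
  (fun z => log_kernel z.1 z.2))//.
- exact: measurable_log_kernel.
- by move=> z; exact: log_kernel_ge0.
Qed.

Lemma average_ge t :
  (L <= \int[nu \x nu]_z log_kernel (slope t z.1) (slope t z.2))%E.
Proof. by have [rho [_ ->]] := slope_distribution t; exact: log_energy_ge. Qed.

Lemma energy_ge :
  (L <= \int[nu \x nu]_z (W 1 (z.1 - z.2)%R +
                          (2^-1 * (sqnorm z.1 + sqnorm z.2))%R%:E))%E.
Proof.
have L0 : (0 <= L)%E by apply: integral_ge0 => z _; exact: log_kernel_ge0.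
have mw : measurable_fun setT (fun t => (w t)%:E) by exact/measurable_EFinP.
rewrite energy_average -[leLHS]mule1 -w1 -ge0_integralZl//; last first.
  by move=> t _; rewrite lee_fin.
apply: ge0_le_integral => //.
- by move=> t _; rewrite mule_ge0 ?lee_fin.
- exact: measurable_funeM.
- exact: measurable_average.
- by move=> t _; rewrite muleC lee_wpmul2l ?lee_fin// average_ge.
Qed.

(** [G] is the weighted excess of the line energies over [L]. It is nonnegative with integral at
    most 0, hence zero almost everywhere. On [I] the weight is positive and can be divided out,
    which leaves the equality case of the line problem. *)
Lemma energy_le_distribution :
  (\int[nu \x nu]_z (W 1 (z.1 - z.2)%R +
                     (2^-1 * (sqnorm z.1 + sqnorm z.2))%R%:E) <= L)%E ->
  {ae leb, forall t, I t -> forall A : set (measurableTypeR R), measurable A ->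
    nu (slope t @^-1` A) = sc A}.
Proof.
move=> h.
have Llty := @integral_log_kernel_semicircle_lty R.
have L0 : (0 <= L)%E by apply: integral_ge0 => z _; exact: log_kernel_ge0.
have Lfin : L \is a fin_num by rewrite ge0_fin_numE.
have mw : measurable_fun setT (fun t => (w t)%:E) by exact/measurable_EFinP.
pose G t := ((w t)%:E * Lam t - (w t)%:E * L)%E.
have mwL : measurable_fun setT (fun t => (w t)%:E * L)%E.
  under eq_fun do rewrite muleC.
  exact: measurable_funeM.
have mG : measurable_fun setT G.
  by apply: emeasurable_funB => //; exact: measurable_average.
have wLfin t : ((w t)%:E * L)%E \is a fin_num by rewrite fin_numM.
have G0 t : (0 <= G t)%E.
  by rewrite /G sube_ge0 ?wLfin ?orbT// lee_wpmul2l ?lee_fin// average_ge.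
have GE t : ((w t)%:E * Lam t = (w t)%:E * L + G t)%E.
  by rewrite /G addeC subeK.
have I0 : (\int[leb]_t `|G t| = 0)%E.
  under eq_integral do rewrite gee0_abs//.
  move: h; rewrite energy_average.
  have -> : (\int[leb]_t ((w t)%:E * \int[nu \x nu]_z log_kernel (slope t z.1) (slope t z.2)) =
      \int[leb]_t ((w t)%:E * L + G t))%E by apply: eq_integral => t _; exact: GE.
  rewrite ge0_integralD//; last by move=> t _; rewrite mule_ge0 ?lee_fin.
  under eq_integral do rewrite muleC.
  rewrite ge0_integralZl//; last by move=> t _; rewrite lee_fin.
  rewrite w1 mule1 -{2}(adde0 L) leeD2lE// => G_le0.
  by apply/eqP; rewrite eq_le G_le0 integral_ge0.
have := (ae_eq_integral_abs leb measurableT mG).1 I0.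
apply: filterS => t /(_ Logic.I) Gt It A mA.
have LamE : Lam t = L.
  have := GE t; rewrite Gt adde0 => e.
  have wt : (w t)%:E != 0%E by rewrite eqe gt_eqF// w_gt0.
  have : ((w t)^-1%:E * ((w t)%:E * Lam t) = (w t)^-1%:E * ((w t)%:E * L))%E by rewrite e.
  by rewrite !muleA -EFinM mulVf ?gt_eqF ?w_gt0// !mul1e.
have [rho [rhoE lamE]] := slope_distribution t.
by rewrite -rhoE; apply: log_energy_eq => //; rewrite -lamE.
Qed.

End average.

End minimiser.

(** * Comparison in [alpha] and concentration on the second axis *)

Section main.
Variable R : realType.
Implicit Types (alpha : R) (nu : probability (plane R) R).
Local Notation leb := (@lebesgue_measure R).
Local Notation sc := (@semicircle R).
Local Notation D := (`](- Num.sqrt 2), (Num.sqrt 2)[%classic : set R).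
Local Notation I := `]0%R, (pi : R)[%classic.
Local Notation L := (\int[sc \x sc]_z log_kernel z.1 z.2)%E.

Lemma sqnorm_eq0 (z : plane R) : (sqnorm z == 0) = (z == 0).
Proof.
rewrite paddr_eq0 ?sqr_ge0// !sqrf_eq0; case: z => a b /=.
by apply/andP/eqP => [[/eqP -> /eqP ->]|[-> ->]].
Qed.

Lemma W_le (a b : R) (z : plane R) : a <= b -> (W a z <= W b z)%E.
Proof.
move=> ab; rewrite /W; case: ifP => // _.
by rewrite lee_fin lerD2l ler_wpM2r// divr_ge0 ?sqr_ge0// addr_ge0 ?sqr_ge0.
Qed.

Let kernel alpha (z : plane R * plane R) : \bar R :=
  (W alpha (z.1 - z.2)%R + (2^-1 * (sqnorm z.1 + sqnorm z.2))%R%:E)%E.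

Let measurable_kernel alpha : measurable_fun setT (kernel alpha).
Proof.
have mc (p : plane R * plane R -> plane R) (q : plane R -> R) :
  measurable_fun setT p -> measurable_fun setT q ->
  measurable_fun setT (fun z => q (p z)).
  by move=> mp mq; exact: (measurableT_comp mq mp).
have m1 : measurable_fun setT (fun z : plane R * plane R => z.1) := measurable_fst.
have m2 : measurable_fun setT (fun z : plane R * plane R => z.2) := measurable_snd.
have q1 : measurable_fun setT (fun z : plane R => z.1) := measurable_fst.
have q2 : measurable_fun setT (fun z : plane R => z.2) := measurable_snd.
have md1 : measurable_fun setT (fun z : plane R * plane R => (z.1 - z.2).1).
  by apply: measurable_funB; exact: mc.
have md2 : measurable_fun setT (fun z : plane R * plane R => (z.1 - z.2).2).
  by apply: measurable_funB; exact: mc.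
have md : measurable_fun setT (fun z : plane R * plane R => sqnorm (z.1 - z.2)).
  by apply: measurable_funD; apply: measurable_funX.
have ms : measurable_fun setT (@sqnorm R).
  by apply: measurable_funD; apply: measurable_funX.
apply: emeasurable_funD; last first.
  apply/measurable_EFinP; apply: measurable_funM; first exact: measurable_cst.
  by apply: measurable_funD; exact: mc.
rewrite /W; under eq_fun do rewrite -sqnorm_eq0.
apply: measurable_fun_ifT.
- by apply: measurable_fun_eqr.
- exact: measurable_cst.
- apply/measurable_EFinP; apply: measurable_funD.
    apply: measurable_funN; apply: measurable_funM; first exact: measurable_cst.
    exact: (measurableT_comp (@measurable_ln R) md).
  apply: measurable_funM; first exact: measurable_cst.
  by apply: measurable_funM; [exact: measurable_funX|exact: measurable_funV].
Qed.

(** Read off the averaging formula, whose integrand is nonnegative. *)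
Let kernel1_ge0 z : (0 <= kernel 1 z)%E.
Proof.
rewrite /kernel -kernel_average; apply: integral_ge0 => t _.
by rewrite mule_ge0 ?log_kernel_ge0// lee_fin mulr_ge0 ?sqr_ge0// divr_ge0// pi_ge0.
Qed.

Let kernel_le alpha z : 1 <= alpha -> (kernel 1 z <= kernel alpha z)%E.
Proof. by move=> a1; rewrite leeD2r// W_le. Qed.

Let energy1_le alpha nu : 1 <= alpha ->
  (\int[nu \x nu]_z kernel 1 z <= \int[nu \x nu]_z kernel alpha z)%E.
Proof.
move=> a1; apply: ge0_le_integral => //.
by move=> z _; exact: kernel_le.
Qed.

Let measurable_axis : measurable_fun setT (fun t : measurableTypeR R => (0, t) : plane R).
Proof. by apply/measurable_fun_pair. Qed.

Lemma mu1E (A : set (plane R)) : measurable A ->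
  mu1 R A = sc ((fun t => (0, t)) @^-1` A).
Proof.
move=> mA; rewrite /mu1 /= /product_measure1 integral_dirac//; last first.
  exact: measurable_fun_xsection.
rewrite diracT mul1e /=; congr (sc _).
by apply/seteqP; split => t; rewrite /xsection/= inE.
Qed.

Lemma energy_mu1 alpha : 1 <= alpha -> energy alpha (mu1 R) = (2^-1%:E * L)%E.
Proof.
move=> a1; congr (_ * _)%E.
have := @ge0_integral_image2 _ _ _ _ R sc (mu1 R) _ measurable_axis mu1E
  (kernel alpha) (measurable_kernel alpha).
move=> ->; last by move=> z; exact: le_trans (kernel1_ge0 z) (kernel_le z a1).
apply: eq_integral => -[x y] _; rewrite /kernel /W /log_kernel/=.
rewrite /sqnorm /= subr0 expr0n/= !add0r mul0r mulr0 addr0.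
have -> : ((0, x) - (0, y) == 0 :> plane R) = (x == y).
  by rewrite -sqnorm_eq0 /sqnorm /= subr0 expr0n/= add0r sqrf_eq0 subr_eq0.
case: eqVneq => // xy; rewrite -EFinD; congr (- _ + _)%:E.
rewrite -[(x - y) ^+ 2]real_normK ?num_real// lnXn ?normr_gt0 ?subr_eq0//.
by rewrite (mulr2n (ln _)); move: (ln _) => l; field.
Qed.

Lemma ae_exists_near0 (P : R -> Prop) (e : R) : 0 < e ->
  {ae leb, forall t, I t -> P t} -> exists2 t, 0 < t < e & P t.
Proof.
move=> e0 [B [mB B0 sub]].
have m0 : 0 < Num.min e pi by rewrite lt_min e0 pi_gt0.
have [[t [te Bt]]|/forallNP h] :=
  pselect (exists t, `]0, (Num.min e pi)[%classic t /\ ~ B t).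
  move: te; rewrite /= in_itv/= lt_min => /and3P[t0 te tpi].
  exists t; first by rewrite t0.
  apply: contrapT => nPt; apply: Bt; apply: sub => /= Pt; apply: nPt; apply: Pt.
  by rewrite /= in_itv/= t0.
have : (leb `]0%R, (Num.min e pi)[%classic <= leb B)%E.
  apply: le_measure; rewrite ?inE//.
  by move=> t te; apply: contrapT => Bt; apply: (h t).
by rewrite lebesgue_measure_itv/= lte_fin m0 sube0 [leRHS]B0 leNgt lte_fin m0.
Qed.

(** The cotangent exceeds [n] near 0; in the form without division this is continuity at 0 of
    [cos t - n%:R * sin t]. *)
Lemma steep_near0 (n : nat) :
  exists2 e : R, 0 < e & forall t, 0 < t < e -> 0 < sin t /\ n%:R * sin t < cos t.
Proof.
have cg : continuous (fun t : R => cos t - n%:R * sin t) by continuity.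
have g0 : 0 < cos 0 - n%:R * sin 0 :> R by rewrite cos0 sin0 mulr0 subr0.
have nb : nbhs (0 : R) [set t | 0 < cos t - n%:R * sin t].
  exact: (cvgr_gt (cos 0 - n%:R * sin 0) (cg 0) 0 g0).
have [e /= e0 he] := (nbhs_ballP _ _).1 nb.
exists (Num.min e pi); first by rewrite lt_min e0 pi_gt0.
move=> t /andP[t0]; rewrite lt_min => /andP[te tpi].
split; first by apply: sin_gt0_pi; rewrite t0.
by rewrite -subr_gt0; apply: he; rewrite /ball/= sub0r normrN gtr0_norm.
Qed.

(** An angle with cotangent at least [n] and semicircular slope gives
    [|x.1| * n%:R <= Num.sqrt 2 + |x.2|] almost surely. One angle for each [n] suffices, so only
    countably many null sets are discarded, and the Archimedean property yields [x.1 = 0]. *)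
Lemma slope_distribution_unique nu :
  {ae leb, forall t, I t -> forall A : set (measurableTypeR R), measurable A ->
    nu (slope t @^-1` A) = sc A} ->
  forall A : set (plane R), measurable A -> nu A = mu1 R A.
Proof.
move=> ae_sc.
have good (n : nat) : exists t : R, [/\ 0 < sin t, n%:R * sin t < cos t &
    forall A : set (measurableTypeR R), measurable A -> nu (slope t @^-1` A) = sc A].
  have [e e0 he] := steep_near0 n.
  have [t te tA] := ae_exists_near0 e0 ae_sc.
  by exists t; have [s0 sc'] := he _ te; split.
have msl t : measurable_fun setT (slope t : plane R -> measurableTypeR R).
  exact: (measurable_fun_pair2 t (@measurable_slope R)).
have mD : measurable (D : set (measurableTypeR R)) by [].
have bounded (n : nat) : {ae nu, forall x : plane R, `|x.1| * n%:R <= Num.sqrt 2 + `|x.2| }.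
  have [t [s0 c0 tA]] := good n.
  exists (slope t @^-1` (~` D)); split.
  - by rewrite -[X in measurable X]setTI; apply: (msl t) => //; exact: measurableC.
  - rewrite tA; last exact: measurableC.
    by rewrite probability_setC// [X in (_ - X)%E]semicircle_supp1 subee.
  move=> x /= h Dx; apply: h.
  have nc : n%:R <= cos t / sin t by rewrite ler_pdivlMr// ltW.
  rewrite (le_trans (ler_wpM2l (normr_ge0 _) nc))//.
  have c1 : 0 <= cos t / sin t by rewrite (le_trans _ nc).
  rewrite -[X in _ * X](ger0_norm c1) -normrM.
  have -> : x.1 * (cos t / sin t) = slope t x - x.2 by rewrite /slope addrC addKr.
  rewrite (le_trans (ler_normB _ _))// lerD2r ltW//.
  by move: Dx; rewrite in_itv/= -ltr_norml.
have ae0 : {ae nu, forall x : plane R, x.1 = 0}.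
  have := ae_foralln bounded; apply: filterS => x h.
  apply/eqP; rewrite -normr_eq0 eq_le normr_ge0 andbT leNgt; apply/negP => x0.
  have := archi_boundP (x := (Num.sqrt 2 + `|x.2|) / `|x.1|).
  rewrite divr_ge0 ?addr_ge0// => /(_ isT); rewrite ltr_pdivrMr//.
  by rewrite ltNge mulrC h.
move=> A mA; rewrite mu1E//.
(* Any good angle serves here: where [x.1 = 0] the slope is [x.2], so the law of one slope is the
   law of the second coordinate. *)
have [t [s0 c0 tA]] := good 0.
pose B : set (measurableTypeR R) := (fun s => (0, s)) @^-1` A.
have mB : measurable B.
  by rewrite -[X in measurable X]setTI; exact: measurable_axis.
have mtB : measurable (slope t @^-1` B : set (plane R)).
  by rewrite -[X in measurable X]setTI; exact: msl.
rewrite -/B -tA// -[A]setIT -[slope t @^-1` B]setIT.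
rewrite -(integral_indic nu measurableT mA) -(integral_indic nu measurableT mtB).
apply: ae_eq_integral => //.
- by apply/measurable_EFinP; exact: measurable_indic.
- by apply/measurable_EFinP; exact: measurable_indic.
apply: filterS ae0 => -[x1 x2] /= -> _; rewrite !indicE.
congr (_%:R%:E); congr nat_of_bool.
by apply/idP/idP => /set_mem h; apply/mem_set; move: h;
  rewrite /B /preimage /slope /= mul0r addr0.
Qed.

Lemma mu1_minimiser alpha : 1 <= alpha -> is_minimiser alpha (mu1 R).
Proof.
move=> a1 nu; rewrite energy_mu1// lee_wpmul2l ?lee_fin ?invr_ge0//.
exact: le_trans (energy_ge nu) (energy1_le nu a1).
Qed.

(** Minimality is tested against [mu1] alone: it bounds the energy of [nu] for [alpha], and a
    fortiori for 1, by that of the semicircle law. *)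
Lemma minimiser_unique alpha nu : 1 <= alpha -> is_minimiser alpha nu ->
  forall A : set (plane R), measurable A -> nu A = mu1 R A.
Proof.
move=> a1 /(_ (mu1 R)); rewrite energy_mu1// => h.
apply: slope_distribution_unique; apply: energy_le_distribution.
apply: le_trans (energy1_le nu a1) _.
by move: h; rewrite /energy lee_pmul2l ?fin_numE// lte_fin invr_gt0.
Qed.

End main.

Theorem mainTheorem6 (R : realType) (alpha : R) (halpha : 1 <= alpha) :
  is_minimiser alpha (mu1 R) /\
  (forall nu : probability (plane R) R, is_minimiser alpha nu ->
    forall A : set (plane R), measurable A -> nu A = mu1 R A).
Proof.
split; first exact: mu1_minimiser.
by move=> nu; exact: minimiser_unique.
Qed.
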